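(* Let $p$ be prime and let $(\varphi_{1,X},\varphi_{1,Z})$ and $(\varphi_{2,X},\varphi_{2,Z})$ be two translation-invariant topological CSS codes over $R=\mathbb{Z}_p[\mathbb{Z}^D]$. Suppose that for some $j\ge1$ both satisfy $$\operatorname{Ext}_R^\ell\bigl(\overline{\operatorname{coker}\varphi_{i,X}},R\bigr)=0\quad(\ell>0,\ \ell\ne j),\qquad i=1,2,$$ and that $$\operatorname{Ext}_R^j\bigl(\overline{\operatorname{coker}\varphi_{1,X}}, R\bigr)\cong_R\operatorname{Ext}_R^j\bigl(\overline{\operatorname{coker}\varphi_{2,X}}, R\bigr).$$ Then $\varphi_{1,X}\sim_{R,\mathrm{Cl},\mathrm{st}}\varphi_{2,X}$ (the two codes are connected by a finite-depth, translation-invariant Clifford circuit up to the addition or removal of unentangled product-state ancillas).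
   Context: $R=\mathbb Z_p[\mathbb Z^D]=\mathbb Z_p[x_1^{\pm1},\dots,x_D^{\pm1}]$ with $\mathbb Z_p$-linear involution $\overline{x^{\mathbf v}}=x^{-\mathbf v}$. For an $R$-module $M$, $\overline M$ is the same abelian group with action $r\ast m=\overline r\,m$. For a matrix $\varphi$ over $R$, $\varphi^\dagger:=\overline{\varphi}^{\mathsf T}$. A translation-invariant CSS code over $R$ is a pair of matrices $\varphi_X\in M_{q\times a}(R)$, $\varphi_Z\in M_{q\times b}(R)$ with $\varphi_X^\dagger\varphi_Z=0$. It is topological if $\operatorname{im}\varphi_X=\ker\varphi_Z^\dagger$ and $\operatorname{im}\varphi_Z=\ker\varphi_X^\dagger$. $\operatorname{E}_q(R)\subseteq\operatorname{GL}_q(R)$ is the subgroup generated by $I+rE_{i,j}$, $r\in R$, $i\ne j$. Matrices $\varphi,\varphi'\in M_{q\times a}(R)$ are Clifford $R$-equivalent ($\sim_{R,\mathrm{Cl}}$) if $W\varphi\Phi=\varphi'$ for some $W\in\operatorname{E}_q(R)$, $\Phi\in\operatorname{GL}_a(R)$. Matrices of possibly different sizes satisfy $\varphi\sim_{R,\mathrm{Cl},\mathrm{st}}\varphi'$ if there are integers $\alpha,\beta,\eta,\alpha',\beta',\eta'\ge0$ with $\varphi\oplus I_\alpha\oplus 0_{\beta,\eta}\sim_{R,\mathrm{Cl}}\varphi'\oplus I_{\alpha'}\oplus0_{\beta',\eta'}$ ($0_{\beta,\eta}$ the $\beta\times\eta$ zero matrix). This relation is the algebraic formulation of the circuit statement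 in parentheses. *)

(* Defs.v *)
From HB Require Import structures.
From mathcomp Require Import all_boot all_order all_algebra.
From mathcomp Require Import ring_quotient boolp finmap.
From mathcomp Require Import monalg.

Set Implicit Arguments.
Unset Strict Implicit.
Unset Printing Implicit Defensive.

Import GRing.Theory.

Local Open Scope ring_scope.

(* The group algebra k[G] of an additive group G. The file monalg puts a
   product on {malg k[G]} only when G is a monoid in which 1 has no
   nontrivial factorization, so the convolution product for a group is
   defined here, on an alias of {malg k[G]}. *)

Definition galg (k : comNzRingType) (G : zmodType) : Type := {malg k[G]}.

HB.instance Definition _ (k : comNzRingType) (G : zmodType) :=
  GRing.Lmodule.on (galg k G : Type).

Section GroupAlgebra.
Context (k : comNzRingType) (G : zmodType).
Implicit Types (g : galg k G) (u v : G).

Definition galg_X (u : G) : galg k G := << 1 *g u >>.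

Definition galg_mul g1 g2 : galg k G :=
  \sum_(u <- msupp g1) \sum_(v <- msupp g2) << g1@_u * g2@_v *g (u + v)%R >>.

Lemma galg_mulw (d1 d2 : {fset G}) g1 g2 :
  (msupp g1 `<=` d1 -> msupp g2 `<=` d2 ->
   galg_mul g1 g2 =
     \sum_(u <- d1) \sum_(v <- d2) << g1@_u * g2@_v *g (u + v)%R >>)%fset.
Proof.
move=> le_d1 le_d2; rewrite /galg_mul (big_fset_incl _ le_d1) /=.
  apply/eq_bigr=> u _; apply/big_fset_incl => // v _ /mcoeff_outdom ->.
  by rewrite mulr0 monalgU0.
move=> u _ /mcoeff_outdom g1u.
by rewrite big1 => // v _; rewrite g1u mul0r monalgU0.
Qed.

Lemma galg_mulDl : left_distributive galg_mul +%R.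
Proof.
move=> g1 g2 g.
rewrite (galg_mulw (msuppD_le g1 g2) (fsubset_refl _)).
rewrite (galg_mulw (fsubsetUl _ (msupp g2)) (fsubset_refl (msupp g))).
rewrite (galg_mulw (fsubsetUr (msupp g1) _) (fsubset_refl (msupp g))).
rewrite -big_split /=; apply/eq_bigr=> u _.
rewrite -big_split /=; apply/eq_bigr=> v _.
by rewrite mcoeffD mulrDl monalgUD.
Qed.

Lemma galg_mulC : commutative galg_mul.
Proof.
move=> g1 g2; rewrite /galg_mul exchange_big /=.
apply/eq_bigr=> u _; apply/eq_bigr=> v _.
by rewrite mulrC [in LHS]addrC.
Qed.

Lemma galg_mulDr : right_distributive galg_mul +%R.
Proof. by move=> g g1 g2; rewrite !(galg_mulC g) galg_mulDl. Qed.

Lemma galg_mul0g : left_zero 0 galg_mul.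
Proof. by move=> g; rewrite /galg_mul msupp0 big_seq_fset0. Qed.

Lemma galg_mulg0 : right_zero 0 galg_mul.
Proof. by move=> g; rewrite galg_mulC galg_mul0g. Qed.

Lemma galg_mulUU (a b : k) u v :
  galg_mul << a *g u >> << b *g v >> = << a * b *g (u + v)%R >>.
Proof.
by rewrite (galg_mulw msuppU_le msuppU_le) !big_seq_fset1 !mcoeffUU.
Qed.

Lemma galg_elim (P : galg k G -> Prop) :
    P 0 -> (forall g1 g2, P g1 -> P g2 -> P (g1 + g2)) ->
    (forall a u, P << a *g u >>) ->
  forall g, P g.
Proof. by move=> P0 PD PU g; rewrite (monalgE g); apply: big_ind. Qed.

Lemma galg_mulA : associative galg_mul.
Proof.
move=> g1 g2 g3; elim/galg_elim: g1 => [|g g' IH IH'|a u].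
- by rewrite !galg_mul0g.
- by rewrite !galg_mulDl IH IH'.
elim/galg_elim: g2 => [|g g' IH IH'|b v].
- by rewrite !(galg_mul0g, galg_mulg0).
- by rewrite !(galg_mulDl, galg_mulDr) IH IH'.
elim/galg_elim: g3 => [|g g' IH IH'|c w].
- by rewrite !galg_mulg0.
- by rewrite !galg_mulDr IH IH'.
by rewrite !galg_mulUU mulrA addrA.
Qed.

Lemma galg_mul1g : left_id (galg_X 0) galg_mul.
Proof.
elim/galg_elim => [|g g' IH IH'|a u]; first exact: galg_mulg0.
- by rewrite galg_mulDr IH IH'.
by rewrite galg_mulUU mul1r add0r.
Qed.

Lemma galg_X0_neq0 : galg_X 0 != 0.
Proof. by rewrite monalgU_eq0 oner_neq0. Qed.

HB.instance Definition _ := GRing.Zmodule_isComNzRing.Build (galg k G)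
  galg_mulA galg_mulC galg_mul1g galg_mulDl galg_X0_neq0.

Definition bar g : galg k G := \sum_(u <- msupp g) << g@_u *g (- u)%R >>.

Lemma barE g u : (bar g)@_u = g@_(- u).
Proof.
rewrite raddf_sum /=; have [hu|hu] := boolP (- u \in msupp g).
  rewrite (big_fsetD1 _ hu) /= mcoeffU opprK eqxx mulr1n big1_fset ?addr0 //.
  move=> v; rewrite in_fsetD1 mcoeffU => /andP[nvu _] _.
  by rewrite eqr_oppLR (negPf nvu).
rewrite (mcoeff_outdom hu) big1_fset // => v hv _.
by rewrite mcoeffU eqr_oppLR; case: eqP hv hu => // -> ->.
Qed.

Lemma bar_is_zmod_morphism : zmod_morphism bar.
Proof. by move=> g1 g2; apply/malgP=> u; rewrite mcoeffB !barE mcoeffB. Qed.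

HB.instance Definition _ :=
  GRing.isZmodMorphism.Build (galg k G) (galg k G) bar bar_is_zmod_morphism.

Lemma barU (a : k) u : bar << a *g u >> = << a *g (- u)%R >>.
Proof. by apply/malgP=> v; rewrite barE !mcoeffU eqr_oppLR. Qed.

Lemma bar_is_monoid_morphism : monoid_morphism bar.
Proof.
split=> [|g1 g2]; first by rewrite barU oppr0.
elim/galg_elim: g1 => [|g g' IH IH'|a u].
- by rewrite mul0r raddf0 mul0r.
- by rewrite mulrDl !raddfD /= IH IH' mulrDl.
elim/galg_elim: g2 => [|g g' IH IH'|b v].
- by rewrite mulr0 raddf0 mulr0.
- by rewrite mulrDr !raddfD /= IH IH' mulrDr.
by rewrite /GRing.mul /= galg_mulUU !barU galg_mulUU opprD.
Qed.

HB.instance Definition _ :=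
  GRing.isMonoidMorphism.Build (galg k G) (galg k G) bar bar_is_monoid_morphism.

End GroupAlgebra.

(* Z_p[x_1^{+-1}, ..., x_D^{+-1}] for p prime. *)
Notation laurent p D := (galg 'F_p 'rV[int]_D).

Section Hom.
Context (R : comNzRingType) (M N : lmodType R).
Implicit Types f g h : {linear M -> N}.

HB.instance Definition _ := gen_eqMixin {linear M -> N}.
HB.instance Definition _ := gen_choiceMixin {linear M -> N}.

Lemma homP f g : f =1 g -> f = g.
Proof.
case: f g => [f [[f1] [f2]]] [g [[g1] [g2]]] /= /funext fg; subst g.
by rewrite (Prop_irrelevance f1 g1) (Prop_irrelevance f2 g2).
Qed.

Definition hom0 : {linear M -> N} := \0 : M -> N.
Definition homN f : {linear M -> N} := \- f : M -> N.
Definition homD f g : {linear M -> N} := f \+ g : M -> N.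
Definition homZ (r : R) f : {linear M -> N} := r \*: f : M -> N.

Lemma homDA : associative homD.
Proof. by move=> f g h; apply: homP => x; apply: addrA. Qed.

Lemma homDC : commutative homD.
Proof. by move=> f g; apply: homP => x; apply: addrC. Qed.

Lemma hom0D : left_id hom0 homD.
Proof. by move=> f; apply: homP => x; apply: add0r. Qed.

Lemma homND : left_inverse hom0 homN homD.
Proof. by move=> f; apply: homP => x; apply: addNr. Qed.

HB.instance Definition _ :=
  GRing.isZmodule.Build {linear M -> N} homDA homDC hom0D homND.

Lemma homZA r s f : homZ r (homZ s f) = homZ (r * s) f.
Proof. by apply: homP => x; apply: scalerA. Qed.

Lemma hom1Z : left_id 1 homZ.
Proof. by move=> f; apply: homP => x; apply: scale1r. Qed.

Lemma homZDr : right_distributive homZ +%R.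
Proof. by move=> r f g; apply: homP => x; apply: scalerDr. Qed.

Lemma homZDl f : {morph homZ^~ f : r s / r + s}.
Proof. by move=> r s; apply: homP => x; apply: scalerDl. Qed.

HB.instance Definition _ :=
  GRing.Zmodule_isLmodule.Build R {linear M -> N} homZA hom1Z homZDr homZDl.

End Hom.

Section Precomp.
Context (R : comNzRingType) (L M N : lmodType R) (d : {linear L -> M}).

Definition precomp (f : {linear M -> N}) : {linear L -> N} := f \o d.

Lemma precomp_is_linear : linear precomp.
Proof. by move=> r f g; apply: homP. Qed.

HB.instance Definition _ :=
  GRing.isLinear.Build R {linear M -> N} {linear L -> N} _ precomp
    precomp_is_linear.
End Precomp.

Section KernelImage.
Context (R : comNzRingType) (M N : lmodType R) (f : {linear M -> N}).

Definition ker_pred : {pred M} := fun x => f x == 0.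

Lemma ker_pred_submod : submod_closed ker_pred.
Proof.
split=> [|r x y]; rewrite !unfold_in ?linear0 // => /eqP fx /eqP fy.
by rewrite linearP fx fy scaler0 addr0.
Qed.

HB.instance Definition _ :=
  GRing.isSubmodClosed.Build R M ker_pred ker_pred_submod.

Definition kermod : Type := {x : M | ker_pred x}.
HB.instance Definition _ := [isSub of kermod for @sval M ker_pred].
HB.instance Definition _ := [Choice of kermod by <:].
HB.instance Definition _ := [SubChoice_isSubLmodule of kermod by <:].

Definition im_pred : {pred N} := fun y => `[< exists x, y = f x >].

Lemma im_pred_submod : submod_closed im_pred.
Proof.
split=> [|r _ _ /asboolP[x ->] /asboolP[y ->]]; apply/asboolP.
  by exists 0; rewrite linear0.
by exists (r *: x + y); rewrite linearP.
Qed.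

HB.instance Definition _ :=
  GRing.isSubmodClosed.Build R N im_pred im_pred_submod.
End KernelImage.

Section Cokernel.
Context (R : comNzRingType) (M N : lmodType R) (f : {linear M -> N}).

Definition cokmod : Type := Quotient.quot (im_pred f).
HB.instance Definition _ := GRing.Zmodule.on cokmod.

Definition cokproj (x : N) : cokmod := (\pi_(Quotient.quot (im_pred f)) x)%qT.

Lemma cokproj_eq x y : (cokproj x = cokproj y) <-> exists z, x - y = f z.
Proof.
rewrite /cokproj; split=> [/eqP|h]; last apply/eqP.
  by rewrite -Quotient.idealrBE => /asboolP.
by rewrite -Quotient.idealrBE; apply/asboolP.
Qed.

Definition cokscale (r : R) (x : cokmod) : cokmod := cokproj (r *: (repr x : N)).

Lemma cokproj_is_zmod_morphism : zmod_morphism cokproj.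
Proof. exact: pi_is_zmod_morphism. Qed.

HB.instance Definition _ :=
  GRing.isZmodMorphism.Build N cokmod cokproj cokproj_is_zmod_morphism.

Lemma cokprojK (x : cokmod) : cokproj (repr x) = x.
Proof. exact: reprK. Qed.

Lemma cokscaleE r x : cokscale r (cokproj x) = cokproj (r *: x).
Proof.
apply/cokproj_eq; have /cokproj_eq[z hz] := cokprojK (cokproj x).
by exists (r *: z); rewrite -scalerBr hz linearZ.
Qed.

Lemma cokscaleA r s x : cokscale r (cokscale s x) = cokscale (r * s) x.
Proof. by rewrite -(cokprojK x) !cokscaleE scalerA. Qed.

Lemma cok1scale : left_id 1 cokscale.
Proof. by move=> x; rewrite -(cokprojK x) cokscaleE scale1r. Qed.

Lemma cokscaleDr : right_distributive cokscale +%R.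
Proof.
move=> r x y; rewrite -(cokprojK x) -(cokprojK y) -raddfD !cokscaleE -raddfD.
by rewrite scalerDr.
Qed.

Lemma cokscaleDl x : {morph cokscale^~ x : r s / r + s}.
Proof.
by move=> r s; rewrite -(cokprojK x) !cokscaleE -raddfD scalerDl.
Qed.

HB.instance Definition _ := GRing.Zmodule_isLmodule.Build R cokmod
  cokscaleA cok1scale cokscaleDr cokscaleDl.

Lemma cokproj_is_scalable : scalable cokproj.
Proof. by move=> r x; rewrite -cokscaleE. Qed.

HB.instance Definition _ :=
  GRing.isScalable.Build R N cokmod _ cokproj cokproj_is_scalable.

End Cokernel.

Section Cohomology.
Context (R : comNzRingType) (A B C : lmodType R).
Context (f : {linear A -> B}) (g : {linear B -> C}) (gf0 : forall x, g (f x) = 0).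

Lemma corestr_subproof x : ker_pred g (f x).
Proof. exact/eqP. Qed.

Definition corestr (x : A) : kermod g := Sub (f x) (corestr_subproof x).

Lemma corestr_is_linear : linear corestr.
Proof. by move=> r x y; apply: val_inj; rewrite /= linearP. Qed.

HB.instance Definition _ :=
  GRing.isLinear.Build R A (kermod g) _ corestr corestr_is_linear.

Definition cohomology : lmodType R := cokmod corestr.
End Cohomology.

(* {malg R[M]} is the free R-module on the underlying set of M, and aug
   its canonical map onto M. *)
Section FreeModule.
Context (R : comNzRingType) (M : lmodType R).

Definition aug (g : {malg R[M]}) : M := \sum_(x <- msupp g) g@_x *: x.

Lemma augw (d : {fset M}) g :
  (msupp g `<=` d)%fset -> aug g = \sum_(x <- d) g@_x *: x.
Proof.
move=> le_d; rewrite /aug (big_fset_incl _ le_d) //= => x _ /mcoeff_outdom ->.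
by rewrite scale0r.
Qed.

Lemma aug_is_linear : linear aug.
Proof.
move=> r g h; pose d := (msupp g `|` msupp h `|` msupp (r *: g + h))%fset.
have dg : (msupp g `<=` d)%fset by rewrite /d -fsetUA fsubsetUl.
have dh : (msupp h `<=` d)%fset.
  by rewrite /d fsetUAC fsubsetUr.
have dgh : (msupp (r *: g + h) `<=` d)%fset by rewrite /d fsubsetUr.
rewrite (augw dg) (augw dh) (augw dgh) scaler_sumr -big_split /=.
by apply: eq_bigr => x _; rewrite mcoeffD mcoeffZ scalerDl scalerA.
Qed.

HB.instance Definition _ :=
  GRing.isLinear.Build R {malg R[M]} M _ aug aug_is_linear.

Lemma aug_surj x : exists g, aug g = x.
Proof.
by exists << 1 *g x >>; rewrite (augw msuppU_le) big_seq_fset1 mcoeffUU scale1r.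
Qed.
End FreeModule.

(* Ext^n(M, N) is the n-th cohomology of Hom(F_*, N), where F_* = res is
   the canonical free resolution of M: F_n is the free module on the set
   of elements of syz n, with syz 0 = M and
   syz (n + 1) = ker (F_n -> syz n). *)
Section Ext.
Context (R : comNzRingType) (M N : lmodType R).

Fixpoint syz (n : nat) : lmodType R :=
  if n is n'.+1 then kermod (@aug R (syz n')) : lmodType R else M.

Definition res (n : nat) : lmodType R := {malg R[syz n]}.

Definition res_d (n : nat) (x : res n.+1) : res n :=
  val (aug x : kermod (@aug R (syz n))).

Lemma res_d_is_linear n : linear (@res_d n).
Proof. by move=> r x y; rewrite /res_d !linearP. Qed.

HB.instance Definition _ n :=
  GRing.isLinear.Build R (res n.+1) (res n) _ (@res_d n) (@res_d_is_linear n).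

Lemma res_exact0 (y : res 0) :
  aug y = 0 <-> exists x : res 1, res_d x = y.
Proof.
split=> [y0|[x <-]]; last by apply/eqP; exact: (valP (aug x : kermod _)).
have yK : ker_pred (@aug R M) y by apply/eqP.
have [x hx] := aug_surj (Sub y yK : kermod (@aug R (syz 0))).
by exists x; rewrite /res_d hx SubK.
Qed.

Lemma res_exactS n (y : res n.+1) :
  res_d y = 0 <-> exists x : res n.+2, res_d x = y.
Proof.
have dE : res_d y = 0 <-> aug y = 0.
  by split=> [h|h]; [apply: val_inj; rewrite [LHS]h raddf0
                    | rewrite /res_d h raddf0].
rewrite dE; split=> [y0|[x <-]]; last by apply/eqP; exact: (valP (aug x : kermod _)).
have yK : ker_pred (@aug R (syz n.+1)) y by apply/eqP.
have [x hx] := aug_surj (Sub y yK : kermod (@aug R (syz n.+1))).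
by exists x; rewrite /res_d hx SubK.
Qed.

Definition delta (n : nat) : {linear {linear res n -> N} -> {linear res n.+1 -> N}} :=
  precomp (@res_d n).

Lemma delta_delta n f : delta n.+1 (delta n f) = 0.
Proof.
apply: homP => x /=; rewrite /res_d /=.
set y := aug x; have /eqP hy : ker_pred (@aug R (syz n.+1)) (val y) by exact: valP.
by rewrite [aug _]hy /= linear0.
Qed.

Definition Ext (n : nat) : lmodType R :=
  if n is n'.+1 then cohomology (@delta_delta n') else kermod (delta 0).
End Ext.

Definition lmod_iso (R : comNzRingType) (M N : lmodType R) : Prop :=
  exists f : {linear M -> N}, bijective f.

Definition trivial_mod (R : comNzRingType) (M : lmodType R) : Prop :=
  forall x : M, x = 0.

(* M with the action r * m := s(r) m. *)
Definition twist (R : comNzRingType) (s : {rmorphism R -> R})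
  (M : lmodType R) : Type := M.

HB.instance Definition _ (R : comNzRingType) (s : {rmorphism R -> R})
  (M : lmodType R) := GRing.Zmodule.on (twist s M).

Section Twist.
Context (R : comNzRingType) (s : {rmorphism R -> R}) (M : lmodType R).

Definition twist_scale (r : R) (x : twist s M) : twist s M := s r *: (x : M).

Lemma twist_scaleA r t x :
  twist_scale r (twist_scale t x) = twist_scale (r * t) x.
Proof. by rewrite /twist_scale scalerA rmorphM. Qed.

Lemma twist_scale1 : left_id 1 twist_scale.
Proof. by move=> x; rewrite /twist_scale rmorph1 scale1r. Qed.

Lemma twist_scaleDr : right_distributive twist_scale +%R.
Proof. by move=> r x y; apply: scalerDr. Qed.

Lemma twist_scaleDl x : {morph twist_scale^~ x : r t / r + t}.
Proof. by move=> r t; rewrite /twist_scale rmorphD scalerDl. Qed.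

HB.instance Definition _ := GRing.Zmodule_isLmodule.Build R (twist s M)
  twist_scaleA twist_scale1 twist_scaleDr twist_scaleDl.
End Twist.

Definition coker (R : comNzRingType) (q a : nat) (phi : 'M[R]_(q, a)) :
    lmodType R :=
  cokmod (mulmx phi : {linear 'cV[R]_a -> 'cV[R]_q}).

Section Codes.
Context (k : comNzRingType) (G : zmodType).
Local Notation R := (galg k G).

Definition conj_mod (M : lmodType R) : lmodType R := twist (@bar k G) M.

Definition dagger (q a : nat) (phi : 'M[R]_(q, a)) : 'M[R]_(a, q) :=
  (map_mx (@bar k G) phi)^T.

Definition css_code (q a b : nat)
    (phiX : 'M[R]_(q, a)) (phiZ : 'M[R]_(q, b)) : Prop :=
  dagger phiX *m phiZ = 0.

Definition im_eq_ker (q a b : nat)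
    (phi : 'M[R]_(q, a)) (psi : 'M[R]_(b, q)) : Prop :=
  forall v : 'cV[R]_q, (exists u : 'cV[R]_a, v = phi *m u) <-> psi *m v = 0.

Definition topological_css_code (q a b : nat)
    (phiX : 'M[R]_(q, a)) (phiZ : 'M[R]_(q, b)) : Prop :=
  [/\ css_code phiX phiZ,
      im_eq_ker phiX (dagger phiZ) & im_eq_ker phiZ (dagger phiX)].
End Codes.

Section Clifford.
Context (R : comNzRingType).

Definition in_GL (n : nat) (A : 'M[R]_n) : Prop :=
  exists B : 'M[R]_n, A *m B = 1%:M /\ B *m A = 1%:M.

(* E_n(R); closure under inverses is automatic, since the inverse of
   1 + r E_ij is 1 - r E_ij. *)
Inductive in_E (n : nat) : 'M[R]_n -> Prop :=
| in_E_gen (r : R) (i j : 'I_n) : i != j -> in_E (1%:M + r *: delta_mx i j)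
| in_E_one : in_E 1%:M
| in_E_mul (A B : 'M[R]_n) : in_E A -> in_E B -> in_E (A *m B).

Definition cliff_equiv (q a : nat) (phi phi' : 'M[R]_(q, a)) : Prop :=
  exists (W : 'M[R]_q) (Phi : 'M[R]_a),
    [/\ in_E W, in_GL Phi & W *m phi *m Phi = phi'].

(* phi (+) I_al (+) 0_{be,et}. *)
Definition stab (q a : nat) (phi : 'M[R]_(q, a)) (al be et : nat) :
    'M[R]_(q + al + be, a + al + et) :=
  block_mx (block_mx phi 0 0 1%:M) 0 0 0.

(* The equations eq_q and eq_a say that the two enlarged matrices have the
   same size. *)
Definition cliff_stequiv (q a q' a' : nat)
    (phi : 'M[R]_(q, a)) (phi' : 'M[R]_(q', a')) : Prop :=
  exists (al be et al' be' et' : nat)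
         (eq_q : (q' + al' + be' = q + al + be)%N)
         (eq_a : (a' + al' + et' = a + al + et)%N),
    cliff_equiv (stab phi al be et)
                (castmx (eq_q, eq_a) (stab phi' al' be' et')).
End Clifford.

(* Main.v *)
From HB Require Import structures.
Require Import Defs.
From mathcomp Require Import all_boot all_order all_algebra.
From mathcomp Require Import boolp finmap monalg zify.

Set Implicit Arguments.
Unset Strict Implicit.
Unset Printing Implicit Defensive.

Import GRing.Theory.

Local Open Scope ring_scope.

(* Let M be the conjugate of coker phiX. Every finitely presented R-module has
   a finite resolution by finitely generated free modules (Hilbert's syzygy
   theorem for Laurent polynomials), so Ext(M, R) is the cohomology of a
   bounded complex of matrices D_n, the transposes of the differentials.
   Beyond degree j this complex is exact, hence split, so an isomorphism of
   the Ext^j lifts to a stable equivalence between the matrices D_(j-1) of the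
   two codes. In degrees 1, ..., j - 1 the complex is exact, which carries the
   stable equivalence down to D_0, the transpose of conj(phiX). Stable
   equivalence is invariant under transposition and conjugation, whence the
   cokernels of the two phiX are isomorphic up to projective summands; these
   are stably free, again by the syzygy theorem. An isomorphism of cokernels
   lifts to an equivalence of the matrices themselves (Fitting), which
   Whitehead's lemma turns into one by elementary matrices. *)

(** * Finite free resolutions *)

(** Modules enter only as kernels, images and cokernels of matrices. [ffr] speaks of a kernel, and
    the syzygy theorem needs it to depend only on the image: this is Schanuel's lemma, [ffr_im].
    Noetherianity runs through the same induction on the variables because the passage to [{poly A}]
    needs finitely many generators for the low-degree parts of a submodule. Finite length of the
    resolutions is used twice. Ext^j = ker D_j / im D_(j-1) is a submodule of the cokernel of
    D_(j-1), and a map defined on it is a matrix only if ker D_j is a direct summand; the splitting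
    is built downwards from the zero end of the complex. Later, finite length makes the image of an
    idempotent stably free. What remains between two isomorphic cokernels are free summands, a left
    factor that is invertible but perhaps not elementary, and column factors that need not be
    invertible. Identity blocks, zero rows and zero columns absorb them, and these are the
    ancillas. *)

Section FiniteFreeResolution.
Context (R : comNzRingType).

Definition im_mx n m (B : 'M[R]_(n, m)) (v : 'cV[R]_n) : Prop :=
  exists u : 'cV[R]_m, v = B *m u.

Definition mxexact n m p (B : 'M[R]_(m, p)) (A : 'M[R]_(n, m)) : Prop :=
  forall v : 'cV[R]_m, A *m v = 0 <-> im_mx B v.

Lemma im_mx_lift n m s (B : 'M[R]_(n, m)) (V : 'M[R]_(n, s)) :
  (forall u : 'cV[R]_s, im_mx B (V *m u)) -> exists U, V = B *m U.
Proof.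
move=> h; have {}h (j : 'I_s) : exists u : 'cV[R]_m, col j V = B *m u.
  by have [u hu] := h (delta_mx j 0); exists u; rewrite colE.
have [f hf] := choice h.
exists (\matrix_(i, j) f j i 0); apply/matrixP => i j.
have /matrixP/(_ i 0) := hf j; rewrite !mxE => ->.
by apply: eq_bigr => k _; rewrite !mxE.
Qed.

Lemma mxexact_lift n m p s (B : 'M[R]_(m, p)) (A : 'M[R]_(n, m))
    (V : 'M[R]_(m, s)) :
  mxexact B A -> A *m V = 0 -> exists U, V = B *m U.
Proof. by move=> ex AV0; apply: im_mx_lift => u; apply/ex; rewrite mulmxA AV0 mul0mx. Qed.

Lemma mxexact_mul0 n m p (B : 'M[R]_(m, p)) (A : 'M[R]_(n, m)) :
  mxexact B A -> A *m B = 0.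
Proof.
move=> ex; apply/matrixP => i j; have /ex : im_mx B (B *m delta_mx j 0).
  by exists (delta_mx j 0).
by rewrite mulmxA -colE => /matrixP/(_ i 0); rewrite !mxE.
Qed.

Definition mxinj n m (A : 'M[R]_(n, m)) : Prop :=
  forall v : 'cV[R]_m, A *m v = 0 -> v = 0.

Lemma mxexact0 n m (A : 'M[R]_(n, m)) : mxinj A -> mxexact (0 : 'M_(m, 0)) A.
Proof.
move=> injA v; split=> [/injA-> | [u ->]]; last by rewrite mul0mx mulmx0.
by exists 0; rewrite mulmx0.
Qed.

Fixpoint ffrn (n : nat) q a (A : 'M[R]_(q, a)) : Prop :=
  if n is n'.+1 then exists b (B : 'M[R]_(a, b)), mxexact B A /\ ffrn n' B
  else mxinj A.

(* ker A has a finite resolution by finitely generated free modules *)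
Definition ffr q a (A : 'M[R]_(q, a)) : Prop := exists n, ffrn n A.

Lemma ffrnS n q a (A : 'M[R]_(q, a)) : ffrn n A -> ffrn n.+1 A.
Proof.
elim: n q a A => [|n IH] q a A /=; last first.
  by case=> b [B [exB /IH fB]]; exists b, B.
move=> injA; exists 0%N, 0; split; first exact: mxexact0.
by move=> v _; apply/matrixP => -[].
Qed.

Lemma leq_ffrn n m q a (A : 'M[R]_(q, a)) : (n <= m)%N -> ffrn n A -> ffrn m A.
Proof. by move/subnK <-; elim: (m - n)%N => // k IH /IH; apply: ffrnS. Qed.

Lemma ffr_next q a (A : 'M[R]_(q, a)) :
  ffr A -> exists b (B : 'M[R]_(a, b)), mxexact B A /\ ffr B.
Proof.
by case=> n /ffrnS [b [B [exB fB]]]; exists b, B; split=> //; exists n.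
Qed.

Lemma ffr_step q a b (A : 'M[R]_(q, a)) (B : 'M[R]_(a, b)) :
  mxexact B A -> ffr B -> ffr A.
Proof. by move=> exB [n fB]; exists n.+1, b, B. Qed.

Lemma ffr_mxinj q a (A : 'M[R]_(q, a)) : mxinj A -> ffr A.
Proof. by exists 0%N. Qed.

(** [T] restricts to a bijection from [ker A] to [ker B]. If [P] covers [ker A], then [T *m P]
    covers [ker B] and has the same kernel as [P], so the rest of the resolution is reused. *)
Lemma ffr_ker_bij q a r b (A : 'M[R]_(q, a)) (B : 'M[R]_(r, b)) (T : 'M[R]_(b, a)) :
    (forall u : 'cV_a, A *m u = 0 -> B *m (T *m u) = 0) ->
    (forall v : 'cV_b, B *m v = 0 ->
       exists2 u : 'cV_a, A *m u = 0 & v = T *m u) ->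
    (forall u : 'cV_a, A *m u = 0 -> T *m u = 0 -> u = 0) ->
  ffr A -> ffr B.
Proof.
move=> hT surj inj /ffr_next[c [P [exP [n fP]]]].
exists n.+1, c, (T *m P); split.
  move=> v; split=> [/surj[u /exP[w ->] ->] | [w ->]].
    by exists w; rewrite mulmxA.
  by rewrite -mulmxA; apply: hT; apply/exP; exists w.
have kerE (w : 'cV_c) : T *m P *m w = 0 <-> P *m w = 0.
  split=> [|h]; last by rewrite -mulmxA h mulmx0.
  by rewrite -mulmxA; apply: inj; apply/exP; exists w.
case: n fP => [injP w /kerE /injP // | n [d [Q [exQ fQ]]]].
by exists d, Q; split=> // v; rewrite kerE.
Qed.

Lemma ffr_ker q r a (A : 'M[R]_(q, a)) (B : 'M[R]_(r, a)) :
  (forall u : 'cV_a, A *m u = 0 <-> B *m u = 0) -> ffr A -> ffr B.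
Proof.
move=> h; apply: (ffr_ker_bij (T := 1%:M)) => u.
- by rewrite mul1mx => /h.
- by move=> /h hu; exists u => //; rewrite mul1mx.
- by rewrite mul1mx.
Qed.

(** Horseshoe lemma: by [hY] the kernel of the block matrix is an extension of [ker A] by [ker B].
    The two lengths are first made equal; [Y2] lifts the corner to the next stage, where the
    situation repeats. *)
Lemma ffr_cone q a r s (B : 'M[R]_(q, a)) (A : 'M[R]_(r, s)) (Y : 'M[R]_(q, s)) :
    (forall w : 'cV_s, A *m w = 0 -> im_mx B (Y *m w)) ->
  ffr B -> ffr A -> ffr (block_mx B Y 0 A).
Proof.
move=> hY [n fB] [m fA].
have {fB} := leq_ffrn (leq_maxl n m) fB.
have {fA} := leq_ffrn (leq_maxr n m) fA.
move: (maxn n m) => {m}n fA fB.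
exists n; elim: n q a r s B A Y hY fA fB => [|n IH] q a r s B A Y hY /=.
  move=> injA injB v; rewrite -[v]vsubmxK mul_block_col mul0mx add0r.
  move/eqP; rewrite col_mx_eq0 => /andP[/eqP h1 /eqP /injA h2].
  by move: h1; rewrite h2 mulmx0 addr0 => /injB ->; rewrite col_mx0.
case=> s2 [A2 [exA fA]] [a2 [B2 [exB fB]]].
have [Y2 hY2] : exists Y2, - (Y *m A2) = B *m Y2.
  apply: im_mx_lift => u; rewrite mulNmx -mulmxA.
  have [|w ->] := hY (A2 *m u); first by apply/exA; exists u.
  by exists (- w); rewrite mulmxN.
exists (a2 + s2)%N, (block_mx B2 Y2 0 A2); split; last first.
  apply: IH => // w A2w; apply/exB.
  by rewrite mulmxA -hY2 mulNmx -mulmxA A2w mulmx0 oppr0.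
move=> v; rewrite -[v]vsubmxK; move: (usubmx v) (dsubmx v) => u w {v}.
rewrite mul_block_col mul0mx add0r; split.
  move/eqP; rewrite col_mx_eq0 => /andP[/eqP h1 /eqP /exA[w' hw]].
  have /exB[u' hu] : B *m (u - Y2 *m w') = 0.
    by rewrite mulmxBr mulmxA -hY2 mulNmx -mulmxA -hw opprK.
  exists (col_mx u' w'); rewrite mul_block_col mul0mx add0r -hw.
  by rewrite -hu subrK.
case=> x; rewrite -[x]vsubmxK mul_block_col mul0mx add0r.
case/eq_col_mx=> -> ->; rewrite mulmxDr !mulmxA (mxexact_mul0 exB) -hY2.
by rewrite (mxexact_mul0 exA) !mul0mx add0r mulNmx addNr col_mx0.
Qed.

(* A resolution of the cokernel of an injective map coker A -> coker A'
   induced by X, obtained as a mapping cone. *)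
Lemma ffr_row q a r s (A' : 'M[R]_(q, a)) (A : 'M[R]_(r, s)) (X : 'M[R]_(q, r))
    (Y : 'M[R]_(a, s)) :
    X *m A = A' *m Y ->
    (forall v : 'cV_r, im_mx A' (X *m v) -> im_mx A v) ->
  ffr A' -> ffr A -> ffr (row_mx A' X).
Proof.
move=> hY inj /ffr_next[b [B [exB fB]]] fA.
apply: (ffr_step (B := block_mx B (- Y) 0 A)); last first.
  apply: ffr_cone => // w Aw; apply/exB.
  by rewrite mulNmx mulmxN mulmxA -hY -mulmxA Aw mulmx0 oppr0.
move=> v; rewrite -[v]vsubmxK; move: (usubmx v) (dsubmx v) => u w {v}.
rewrite mul_row_col; split=> [h | [x]].
  have /inj[t ht] : im_mx A' (X *m w).
    by exists (- u); apply/eqP; rewrite mulmxN -addr_eq0 addrC h.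
  have /exB[z hz] : A' *m (u + Y *m t) = 0.
    by rewrite mulmxDr [A' *m (_ *m _)]mulmxA -hY -mulmxA -ht.
  exists (col_mx z t); rewrite mul_block_col mul0mx add0r -ht mulNmx -hz.
  by rewrite addrK.
rewrite -[x]vsubmxK mul_block_col mul0mx add0r => /eq_col_mx[-> ->].
rewrite mulmxDr !mulmxA (mxexact_mul0 exB) mul0mx add0r mulmxN -hY mulNmx.
by rewrite addNr.
Qed.

(** Schanuel's lemma. With [A = B *m T], the kernel of [row_mx A B] is the direct sum of the vectors
    (y, - T y) and a copy of [ker B], with projection (x, v) to T x + v. Generators [C] of that
    kernel thus generate [ker B], and the columns of [L], which express (y, - T y), are added to the
    relations. *)
Lemma ffr_im q a b (A : 'M[R]_(q, a)) (B : 'M[R]_(q, b)) :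
  (forall v, im_mx A v <-> im_mx B v) -> ffr A -> ffr B.
Proof.
move=> imE fA.
have [S hS] : exists S, B = A *m S.
  by apply: im_mx_lift => u; apply/imE; exists u.
have [T hT] : exists T, A = B *m T.
  by apply: im_mx_lift => u; apply/imE; exists u.
have fAB : ffr (row_mx A B).
  apply: (ffr_row (A := 1%:M) (Y := S)); rewrite ?mulmx1 //.
    by move=> v _; exists v; rewrite mul1mx.
  by apply: ffr_mxinj => v; rewrite mul1mx.
have [c [C [exC /ffr_next[c2 [C2 [exC2 fC2]]]]]] := ffr_next fAB.
have [L hL] : exists L, col_mx 1%:M (- T) = C *m L.
  apply: (mxexact_lift exC).
  by rewrite mul_row_col mulmx1 mulmxN -hT subrr.
apply: (ffr_step (B := row_mx T 1%:M *m C)).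
  move=> v; split=> [Bv | [u ->]].
    have /exC[u hu] : row_mx A B *m col_mx 0 v = 0.
      by rewrite mul_row_col mulmx0 add0r.
    exists u; rewrite -mulmxA -hu mul_row_col mulmx0 add0r mul1mx //.
  rewrite 2!mulmxA mul_mx_row -hT mulmx1.
  by rewrite (mxexact_mul0 exC) mul0mx.
(* The added relations are independent of the old ones: [C] kills [C2], and the top block of
   [C *m L] is the identity. *)
have kerE (z : 'cV_c2) (y : 'cV_a) : C2 *m z + L *m y = 0 -> y = 0.
  move/(congr1 (mulmx C)); rewrite mulmxDr !mulmxA (mxexact_mul0 exC2).
  rewrite mul0mx add0r -hL mulmx0 mul_col_mx mul1mx => /eqP.
  by rewrite col_mx_eq0 => /andP[/eqP].
apply: (ffr_step (B := row_mx C2 L)).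
  move=> z; rewrite -mulmxA; split=> [h | [x ->]]; last first.
    rewrite -[x]vsubmxK mul_row_col !mulmxDr !mulmxA -[_ *m C *m C2]mulmxA.
    rewrite (mxexact_mul0 exC2) mulmx0 mul0mx add0r -[_ *m C *m L]mulmxA.
    by rewrite -hL mul_row_col mulmx1 mul1mx subrr mul0mx.
  have hC : C *m z = C *m (L *m usubmx (C *m z)).
    rewrite mulmxA -hL mul_col_mx mul1mx; move: h.
    rewrite -{1 2}[C *m z]vsubmxK mul_row_col mul1mx => /eqP.
    by rewrite addrC addr_eq0 mulNmx => /eqP <-; rewrite vsubmxK.
  have /exC2[y hy] : C *m (z - L *m usubmx (C *m z)) = 0.
    by rewrite mulmxBr -hC subrr.
  exists (col_mx y (usubmx (C *m z))); rewrite mul_row_col -hy subrK //.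
have [c3 [C3 [exC3 fC3]]] := ffr_next fC2.
apply: (ffr_step (B := col_mx C3 0)); last first.
  apply: ffr_ker fC3 => u; rewrite mul_col_mx mul0mx.
  by split=> [->|/eqP]; rewrite ?col_mx0 // col_mx_eq0 => /andP[/eqP].
move=> v; rewrite -[v]vsubmxK mul_row_col; split=> [h|[x]].
  have y0 := kerE _ _ h; move: h; rewrite y0 mulmx0 addr0 => /exC3[x ->].
  by exists x; rewrite mul_col_mx mul0mx.
rewrite mul_col_mx mul0mx => /eq_col_mx[-> ->].
by rewrite mulmx0 addr0 mulmxA (mxexact_mul0 exC3) mul0mx.
Qed.

End FiniteFreeResolution.

(** * The syzygy theorem for polynomial rings *)

Definition submod_pred (R : comNzRingType) n (N : 'cV[R]_n -> Prop) : Prop :=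
  N 0 /\ forall r u v, N u -> N v -> N (r *: u + v).

Definition noetherian (R : comNzRingType) : Prop :=
  forall n (N : 'cV[R]_n -> Prop), submod_pred N ->
  exists m (F : 'M[R]_(n, m)), forall v, N v <-> im_mx F v.

Section SubmodPred.
Context (R : comNzRingType) (n : nat) (N : 'cV[R]_n -> Prop) (sN : submod_pred N).

Lemma sub_add u v : N u -> N v -> N (u + v).
Proof. by case: sN => _ h Nu Nv; rewrite -[u]scale1r; apply: h. Qed.

Lemma sub_scale r u : N u -> N (r *: u).
Proof. by case: sN => N0 h Nu; rewrite -[_ *: _]addr0; apply: h. Qed.

Lemma sub_sub u v : N u -> N v -> N (u - v).
Proof. by move=> Nu /(sub_scale (-1)); rewrite scaleN1r; apply: sub_add. Qed.

Lemma sub_sum I (r : seq I) (F : I -> 'cV[R]_n) :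
  (forall i, N (F i)) -> N (\sum_(i <- r) F i).
Proof.
move=> h; elim: r => [|i r IH]; first by rewrite big_nil; case: sN.
by rewrite big_cons; apply: sub_add.
Qed.

Lemma sub_mulmx m (F : 'M[R]_(n, m)) u : (forall j, N (col j F)) -> N (F *m u).
Proof.
move=> h; suff -> : F *m u = \sum_j u j 0 *: col j F.
  by apply: sub_sum => j; apply: sub_scale.
apply/matrixP => i k; rewrite summxE !mxE ord1; apply: eq_bigr => j _.
by rewrite !mxE mulrC.
Qed.
End SubmodPred.

Lemma im_mx_submod (R : comNzRingType) n m (F : 'M[R]_(n, m)) :
  submod_pred (im_mx F).
Proof.
split=> [|r _ _ [u ->] [v ->]]; first by exists 0; rewrite mulmx0.
by exists (r *: u + v); rewrite mulmxDr scalemxAr.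
Qed.

(** * Matrices over a polynomial ring and their coefficient matrices *)

Section PolyMatrix.
Context (A : comNzRingType).
Local Notation C := {poly A}.
Local Notation "M ^pC" := (map_mx (@polyC A) M) (at level 2, format "M ^pC").

Definition coef_mx i m n (M : 'M[C]_(m, n)) : 'M[A]_(m, n) :=
  \matrix_(x, y) (M x y)`_i.

(** The bound is on sizes, so the degrees are less than [d]; linear entries mean [d = 2]. *)
Definition bounded_mx d m n (M : 'M[C]_(m, n)) : Prop :=
  forall x y, (size (M x y) <= d)%N.

Lemma coef_mx_mulC i m n p (M : 'M[A]_(m, n)) (V : 'M[C]_(n, p)) :
  coef_mx i (M^pC *m V) = M *m coef_mx i V.
Proof.
apply/matrixP => x y; rewrite !mxE coef_sum; apply: eq_bigr => z _.
by rewrite !mxE coefCM.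
Qed.

Lemma coef_mxB i m n (M N : 'M[C]_(m, n)) :
  coef_mx i (M - N) = coef_mx i M - coef_mx i N.
Proof. by apply/matrixP => x y; rewrite !mxE coefB. Qed.

Lemma coef_mxD i m n (M N : 'M[C]_(m, n)) :
  coef_mx i (M + N) = coef_mx i M + coef_mx i N.
Proof. by apply/matrixP => x y; rewrite !mxE coefD. Qed.

Lemma coef_mx0 i m n : coef_mx i (0 : 'M[C]_(m, n)) = 0.
Proof. by apply/matrixP => x y; rewrite !mxE coef0. Qed.

Lemma coef_mx_XnZ i k m n (M : 'M[C]_(m, n)) :
  coef_mx (k + i) ('X^k *: M) = coef_mx i M.
Proof. by apply/matrixP => x y; rewrite !mxE coefXnM ltnNge leq_addr addKn. Qed.

Lemma coef_mx_CZ r m n (M : 'M[C]_(m, n)) i :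
  coef_mx i (r%:P *: M) = r *: coef_mx i M.
Proof. by apply/matrixP => x y; rewrite !mxE coefCM. Qed.

Lemma coef_mx_large d i m n (M : 'M[C]_(m, n)) :
  bounded_mx d M -> (d <= i)%N -> coef_mx i M = 0.
Proof.
move=> h le_di; apply/matrixP => x y; rewrite !mxE nth_default //.
exact: leq_trans (h x y) le_di.
Qed.

Lemma bounded_mx_ex m n (M : 'M[C]_(m, n)) : exists d, bounded_mx d M.
Proof.
exists (\max_x \max_y size (M x y)) => x y.
by apply: leq_trans (leq_bigmax x); apply: (leq_bigmax y).
Qed.

Lemma bounded_mx_leq d e m n (M : 'M[C]_(m, n)) :
  (d <= e)%N -> bounded_mx d M -> bounded_mx e M.
Proof. by move=> le_de h x y; apply: leq_trans le_de. Qed.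

Lemma bounded_mxB d m n (M N : 'M[C]_(m, n)) :
  bounded_mx d M -> bounded_mx d N -> bounded_mx d (M - N).
Proof.
move=> hM hN x y; rewrite !mxE (leq_trans (size_polyD _ _)) // size_polyN.
by rewrite geq_max hM hN.
Qed.

Lemma bounded_mxD d m n (M N : 'M[C]_(m, n)) :
  bounded_mx d M -> bounded_mx d N -> bounded_mx d (M + N).
Proof.
move=> hM hN x y; rewrite !mxE (leq_trans (size_polyD _ _)) //.
by rewrite geq_max hM hN.
Qed.

Lemma bounded_mxXn d k m n (M : 'M[C]_(m, n)) :
  bounded_mx d M -> bounded_mx (k + d) ('X^k *: M).
Proof.
move=> hM x y; rewrite !mxE (leq_trans (size_polyMleq _ _)) // size_polyXn /=.
by rewrite leq_add2l.
Qed.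

Lemma bounded_mx_lead d m n (M : 'M[C]_(m, n)) :
  bounded_mx d.+1 M -> coef_mx d M = 0 -> bounded_mx d M.
Proof.
move=> hM /matrixP h x y; have := h x y; rewrite !mxE => cd.
apply/leq_sizeP => i; rewrite leq_eqVlt => /orP[/eqP <- //|lt_di].
by rewrite nth_default // (leq_trans (hM x y)).
Qed.

Lemma bounded_mx_mul d m n p (M : 'M[C]_(m, n)) (V : 'M[A]_(n, p)) :
  bounded_mx d M -> bounded_mx d (M *m V^pC).
Proof.
move=> hM x y; rewrite mxE (leq_trans (size_sum _ _ _)) //.
apply/bigmax_leqP => z _; rewrite mxE mulrC mul_polyC.
exact: leq_trans (size_scale_leq _ _) (hM x z).
Qed.

Lemma coef_mx_mul i m n p (M : 'M[C]_(m, n)) (V : 'M[A]_(n, p)) :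
  coef_mx i (M *m V^pC) = coef_mx i M *m V.
Proof.
apply/matrixP => x y; rewrite !mxE coef_sum; apply: eq_bigr => z _.
by rewrite !mxE coefMC.
Qed.

Lemma coef_mx_expand d m n (M : 'M[C]_(m, n)) :
  bounded_mx d M -> M = \sum_(i < d) 'X^i *: (coef_mx i M)^pC.
Proof.
move=> hM; apply/matrixP => x y.
rewrite summxE -[LHS](take_poly_id (hM x y)) /take_poly poly_def.
by apply: eq_bigr => i _; rewrite !mxE mulrC mul_polyC.
Qed.

Lemma im_mx_polyC n m (F : 'M[A]_(n, m)) (v : 'cV[C]_n) :
  im_mx F^pC v <-> forall i, im_mx F (coef_mx i v).
Proof.
split=> [[u ->] i|h]; first by exists (coef_mx i u); rewrite coef_mx_mulC.
have [d /coef_mx_expand ->] := bounded_mx_ex v.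
have sF := im_mx_submod F^pC.
apply: sub_sum => // i; apply: sub_scale => //.
by have [u ->] := h i; exists u^pC; rewrite -map_mxM.
Qed.

Lemma mulmx_polyC_eq0 n m (F : 'M[A]_(n, m)) (v : 'cV[C]_m) :
  F^pC *m v = 0 <-> forall i, F *m coef_mx i v = 0.
Proof.
split=> [h i|h]; first by rewrite -coef_mx_mulC h coef_mx0.
apply/matrixP => x y; apply/polyP => i; rewrite !ord1.
by have := h i; rewrite -coef_mx_mulC => /matrixP/(_ x 0); rewrite !mxE coef0.
Qed.

Lemma ffr_polyC q a (F : 'M[A]_(q, a)) : ffr F -> ffr F^pC.
Proof.
case=> n; elim: n q a F => [|n IH] q a F /=.
  move=> injF; apply: ffr_mxinj => v /mulmx_polyC_eq0 h.
  apply/matrixP => x y; apply/polyP => i; rewrite !ord1.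
  by have /matrixP/(_ x 0) := injF _ (h i); rewrite !mxE coef0.
case=> b [B [exB /IH fB]]; apply: ffr_step fB => v.
by rewrite mulmx_polyC_eq0 im_mx_polyC; split=> h i; apply/exB.
Qed.

(** * Hilbert's basis theorem for submodules of a free module *)

Section HilbertBasis.
Context (noethA : noetherian A) (n : nat) (N : 'cV[C]_n -> Prop).
Context (sN : submod_pred N).

(** The analogue for vectors of the ideal of leading coefficients. The degree [d] is nominal:
    vectors of lower degree contribute 0, which makes this a submodule. *)
Definition lead_pred d (c : 'cV[A]_n) : Prop :=
  exists v, [/\ N v, bounded_mx d.+1 v & coef_mx d v = c].

Lemma lead_pred_submod d : submod_pred (lead_pred d).
Proof.
split=> [|r _ _ [u [Nu bu <-]] [v [Nv bv <-]]].
  exists 0; split; rewrite ?coef_mx0 //; first by case: sN.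
  by move=> x y; rewrite mxE size_poly0.
exists (r%:P *: u + v); split; first by apply: sub_add => //; apply: sub_scale.
  apply: bounded_mxD => // x y; rewrite mxE mul_polyC.
  exact: leq_trans (size_scale_leq _ _) (bu x y).
by rewrite coef_mxD coef_mx_CZ.
Qed.

Lemma lead_pred_leq d e c : (d <= e)%N -> lead_pred d c -> lead_pred e c.
Proof.
move=> /subnK <- [v [Nv bv <-]]; exists ('X^(e - d) *: v); split.
- exact: sub_scale.
- by rewrite -addnS; apply: bounded_mxXn.
- exact: coef_mx_XnZ.
Qed.

Lemma lead_gen d : exists m (P : 'M[C]_(n, m)),
  [/\ forall u, N (P *m u), bounded_mx d.+1 P &
      forall c, lead_pred d c -> im_mx (coef_mx d P) c].
Proof.
have [m [F hF]] := noethA (lead_pred_submod d).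
have /choice[f hf] (j : 'I_m) :
    exists v, [/\ N v, bounded_mx d.+1 v & coef_mx d v = col j F].
  by apply/hF; exists (delta_mx j 0); rewrite colE.
pose P := \matrix_(i, j) f j i 0.
have colP j : col j P = f j.
  by apply/matrixP => x y; rewrite !mxE !ord1.
exists m, P; split.
- by move=> u; apply: sub_mulmx => // j; rewrite colP; case: (hf j).
- by move=> x j; rewrite mxE; case: (hf j) => _ /(_ x 0).
move=> c /hF; suff -> : coef_mx d P = F by [].
apply/matrixP => x j; rewrite !mxE; case: (hf j) => _ _ /matrixP/(_ x 0).
by rewrite !mxE.
Qed.

Lemma bounded_gen d : exists m (P : 'M[C]_(n, m)),
  (forall u, N (P *m u)) /\ forall v, N v -> bounded_mx d v -> im_mx P v.
Proof.
elim: d => [|d [m1 [P1 [NP1 genP1]]]].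
  exists 0%N, 0; split=> [u|v _ bv]; first by rewrite mul0mx; case: sN.
  exists 0; rewrite mulmx0; apply/matrixP => x y; rewrite mxE.
  by apply/eqP; rewrite -size_poly_leq0.
have [m2 [P2 [NP2 bP2 genP2]]] := lead_gen d.
exists (m1 + m2)%N, (row_mx P1 P2); split=> [u|v Nv bv].
  by rewrite -[u]vsubmxK mul_row_col; apply: sub_add.
have [|w hw] := genP2 (coef_mx d v); first by exists v.
have [||u hu] := genP1 (v - P2 *m w^pC); first exact: sub_sub.
  apply: bounded_mx_lead; last by rewrite coef_mxB coef_mx_mul hw subrr.
  by apply: bounded_mxB => //; apply: bounded_mx_mul.
by exists (col_mx u w^pC); rewrite mul_row_col -hu subrK.
Qed.

(** The increasing union of the modules [lead_pred d] is finitely generated, so it is reached at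
    some [d0]. Beyond degree [d0] every leading vector can be cancelled by a shifted element of
    degree at most [d0]; what is left is covered by [bounded_gen]. *)
Lemma poly_gen : exists m (F : 'M[C]_(n, m)), forall v, N v <-> im_mx F v.
Proof.
have sL : submod_pred (fun c => exists d, lead_pred d c).
  split=> [|r u v [d du] [e ev]]; first by exists 0%N; case: (lead_pred_submod 0).
  exists (maxn d e); case: (lead_pred_submod (maxn d e)) => _; apply.
    exact: lead_pred_leq (leq_maxl _ _) du.
  exact: lead_pred_leq (leq_maxr _ _) ev.
have [m0 [F hF]] := noethA sL.
have /choice[f hf] (j : 'I_m0) : exists d, lead_pred d (col j F).
  by apply/hF; exists (delta_mx j 0); rewrite colE.
pose d0 := \max_j f j.
have stab d c : lead_pred d c -> lead_pred d0 c.
  move=> dc; have /hF[u ->] : exists d, lead_pred d c by exists d.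
  apply: sub_mulmx => [|j]; first exact: lead_pred_submod.
  exact: lead_pred_leq (leq_bigmax j) (hf j).
have [m [P [NP genP]]] := bounded_gen d0.+1.
exists m, P => v; split=> [Nv|[u ->]]; last exact: NP.
have [k bv] : exists k, bounded_mx (k + d0.+1) v.
  by have [k bv] := bounded_mx_ex v; exists k; apply: bounded_mx_leq (leq_addr _ _) bv.
elim: k v Nv bv => [|k IH] v Nv bv; first exact: genP.
(* The top index of [v] is k + (d0 + 1) = (k + 1) + d0, and that of [w] is [d0], hence the shift by
   ['X^(k.+1)] below. *)
have [|w [Nw bw cw]] := stab (k + d0.+1)%N (coef_mx (k + d0.+1) v).
  by exists v; split.
have imw := genP _ Nw bw.
have -> : v = (v - 'X^(k.+1) *: w) + 'X^(k.+1) *: w by rewrite subrK.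
have sP := im_mx_submod P; apply: sub_add (sub_scale _ _ _) => //.
apply: IH; first by apply: sub_sub => //; apply: sub_scale.
apply: bounded_mx_lead.
  apply: bounded_mxB; first by rewrite -addSn.
  by rewrite -addSn; apply: bounded_mxXn.
by rewrite coef_mxB -cw -addSnnS coef_mx_XnZ subrr.
Qed.
End HilbertBasis.

Lemma noetherian_poly : noetherian A -> noetherian C.
Proof. by move=> noethA n N sN; apply: poly_gen. Qed.

Section LinearMatrix.
Context (noethA : noetherian A).
Context (ffrA : forall q a (F : 'M[A]_(q, a)), ffr F).

(* Let N be the submodule generated by F. The quotient C^q / N is the cokernel
   of the injective map C (x) (A^q / N0) -> C (x) (A^(q + q) / N1) given by
   multiplication by 'X minus the shift, where N0 and N1 collect the elements
   of N of degree at most 0 and at most 1. *)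
Lemma ffr_linear q a (F : 'M[C]_(q, a)) : bounded_mx 2 F -> ffr F.
Proof.
move=> bF; pose N := im_mx F; have sN : submod_pred N := im_mx_submod F.
pose ev : 'M[C]_(q, q + q) := row_mx 1%:M 'X%:M.
pose X : 'M[C]_(q + q, q) := col_mx 'X%:M (- 1%:M).
have evX : ev *m X = 0.
  by rewrite mul_row_col mul1mx mulmxN mulmx1 subrr.
have evE (u w : 'cV[C]_q) : ev *m col_mx u w = u + 'X *: w.
  by rewrite mul_row_col mul1mx mul_scalar_mx.
have XE (v : 'cV[C]_q) : X *m v = col_mx ('X *: v) (- v).
  by rewrite mul_col_mx mul_scalar_mx mulNmx mul1mx.
have [|n0 [F0 hF0]] := noethA (N := fun v : 'cV[A]_q => N v^pC).
  split=> [|r u v Nu Nv]; first by rewrite map_mx0; case: sN.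
  by rewrite map_mxD map_mxZ; apply: sub_add => //; apply: sub_scale.
have [|n1 [F1 hF1]] := noethA (N := fun v : 'cV[A]_(q + q) => N (ev *m v^pC)).
  split=> [|r u v Nu Nv]; first by rewrite map_mx0 mulmx0; case: sN.
  rewrite map_mxD map_mxZ mulmxDr -scalemxAr.
  by apply: sub_add => //; apply: sub_scale.
have [Y1 hY1] : exists Y1, col_mx F0 0 = F1 *m Y1.
  apply: im_mx_lift => u; apply/hF1; rewrite mul_col_mx mul0mx.
  by rewrite map_col_mx map_mx0 evE scaler0 addr0; apply/hF0; exists u.
have [Y2 hY2] : exists Y2, col_mx 0 F0 = F1 *m Y2.
  apply: im_mx_lift => u; apply/hF1; rewrite mul_col_mx mul0mx.
  rewrite map_col_mx map_mx0 evE add0r; apply: sub_scale => //.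
  by apply/hF0; exists u.
have XF0 : X *m F0^pC = F1^pC *m ('X *: Y1^pC - Y2^pC).
  rewrite mulmxBr -scalemxAr -!map_mxM -hY1 -hY2 !map_col_mx map_mx0.
  rewrite scale_col_mx scaler0 opp_col_mx add_col_mx oppr0 addr0 add0r.
  by rewrite mul_col_mx mul_scalar_mx mulNmx mul1mx.
(* The coefficient of degree k + 1 of [X *m v] is (v_k, - v_(k+1)), so membership in the image of
   [F1] says that v_k - 'X v_(k+1) lies in [N]. Descending from a degree where v vanishes puts every
   v_k in [N]. *)
have Xinj (v : 'cV[C]_q) : im_mx F1^pC (X *m v) -> im_mx F0^pC v.
  move=> imXv; apply/im_mx_polyC => i; apply/hF0.
  have step k : N (coef_mx k.+1 v)^pC -> N (coef_mx k v)^pC.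
    move=> Nk; have /im_mx_polyC/(_ k.+1)/hF1 := imXv.
    have -> : coef_mx k.+1 (X *m v) = col_mx (coef_mx k v) (- coef_mx k.+1 v).
      rewrite XE; apply/matrixP => x y; rewrite !mxE.
      by case: splitP => z _; rewrite !mxE ?coefXM ?coefN.
    rewrite map_col_mx evE map_mxN scalerN => /(sub_add sN)/(_ (sub_scale sN 'X Nk)).
    by rewrite subrK.
  have [d bv] := bounded_mx_ex v.
  have Nlarge k : N (coef_mx (k + d) v)^pC.
    rewrite (coef_mx_large bv) ?leq_addl // map_mx0; by case: sN.
  have {}Nlarge : N (coef_mx (d + i) v)^pC by rewrite addnC.
  by elim: d {bv} Nlarge => // d IH /step.
have fC : ffr (row_mx F1^pC X).
  by apply: (ffr_row XF0 Xinj); apply: ffr_polyC.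
have kerev (s t : 'cV[C]_q) : s + 'X *: t = 0 -> col_mx s t = X *m (- t).
  move/eqP; rewrite addr_eq0 => /eqP ->.
  by rewrite XE scalerN opprK.
(* The kernel of [ev] is the image of the injective [X], so the kernel of [row_mx F1^pC X] projects
   bijectively onto that of [ev *m F1^pC]. *)
have fev : ffr (ev *m F1^pC).
  apply: (ffr_ker_bij (T := row_mx 1%:M 0)) fC => [u|v|u].
  - rewrite -[u]vsubmxK !mul_row_col mul1mx mul0mx addr0 => /eqP.
    rewrite addr_eq0 -mulmxA => /eqP ->.
    by rewrite mulmxN mulmxA evX mul0mx oppr0.
  - rewrite -mulmxA -[F1^pC *m v]vsubmxK evE => /kerev; rewrite vsubmxK => h.
    exists (col_mx v (dsubmx (F1^pC *m v))).
      by rewrite mul_row_col {1}h mulmxN addNr.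
    by rewrite mul_row_col mul1mx mul0mx addr0.
  - rewrite -[u]vsubmxK !mul_row_col mul1mx mul0mx addr0 => + u0.
    rewrite u0 mulmx0 add0r XE => /eqP; rewrite col_mx_eq0 oppr_eq0.
    by case/andP=> _ /eqP ->; rewrite col_mx0.
(* Degree at most 1 is used here: each column of [F] is [ev] of its two coefficient vectors, so
   [ev *m F1^pC] and [F] generate the same [N]. *)
apply: ffr_im fev => v; split=> [[u ->]|[u ->]].
  apply: sub_mulmx => // j.
  rewrite colE -mulmxA -(map_delta_mx (@polyC A)) -map_mxM.
  by apply/hF1; exists (delta_mx j 0).
apply: sub_mulmx => [|j]; first exact: im_mx_submod.
pose w := col_mx (coef_mx 0 (col j F)) (coef_mx 1 (col j F)).
have colE2 : col j F = ev *m w^pC.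
  rewrite map_col_mx evE {1}(coef_mx_expand (d := 2) (M := col j F)).
    by rewrite big_ord_recl big_ord1 expr0 scale1r expr1.
  by move=> x y; rewrite mxE.
have /hF1[t ht] : N (ev *m w^pC) by rewrite -colE2; exists (delta_mx j 0); rewrite colE.
by exists t^pC; rewrite colE2 ht map_mxM mulmxA.
Qed.

(* Degrees above 1 are removed by replacing F0 + 'X F1 with the block
   matrix [F0, 'X; F1, -1]. *)
Lemma ffr_poly q a (F : 'M[C]_(q, a)) : ffr F.
Proof.
have [d bF] : exists d, bounded_mx d.+2 F.
  have [d bF] := bounded_mx_ex F; exists d.
  by apply: bounded_mx_leq bF; rewrite -addn2 leq_addr.
elim: d q a F bF => [|d IH] q a F bF; first exact: ffr_linear.
pose F0 := map_mx (take_poly 1) F; pose F1 := map_mx (drop_poly 1) F.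
have FE : F = F0 + 'X *: F1.
  by apply/matrixP => x y; rewrite !mxE mulrC -[LHS](poly_take_drop 1).
(* [F0] is constant and [F1] has one degree less than [F]; the inductive bound is at least 2, so the
   entry ['X] fits. *)
have : ffr (block_mx F0 'X%:M F1 (- 1%:M)).
  apply: IH => x y; rewrite !mxE; case: splitP => i _; rewrite !mxE.
    case: splitP => j _; rewrite !mxE; first exact: leq_trans (size_take_poly _ _) _.
    by case: eqP; rewrite ?mulr0n ?size_poly0 // mulr1n size_polyX.
  case: splitP => j _; rewrite !mxE; first by rewrite size_drop_poly leq_subLR.
  by rewrite size_polyN; case: eqP; rewrite ?mulr0n ?size_poly0 // mulr1n size_poly1.
have kerE (u : 'cV_a) (w : 'cV_q) :
    block_mx F0 'X%:M F1 (- 1%:M) *m col_mx u w = 0 <->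
    F *m u = 0 /\ w = F1 *m u.
  rewrite mul_block_col mulNmx mul1mx mul_scalar_mx; split.
    move/eqP; rewrite col_mx_eq0 subr_eq0 => /andP[/eqP h /eqP w_def].
    by rewrite -w_def FE mulmxDl -scalemxAl w_def.
  by case=> + ->; rewrite subrr FE mulmxDl -scalemxAl => ->; rewrite col_mx0.
apply: (ffr_ker_bij (T := row_mx 1%:M 0)) => [u|v Fv|u].
- rewrite -[u]vsubmxK => /kerE[+ _].
  by rewrite mul_row_col mul1mx mul0mx addr0.
- exists (col_mx v (F1 *m v)); first exact/kerE.
  by rewrite mul_row_col mul1mx mul0mx addr0.
rewrite -[u]vsubmxK => /kerE[_ ->].
by rewrite mul_row_col mul1mx mul0mx addr0 => ->; rewrite mulmx0 col_mx0.
Qed.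
End LinearMatrix.
End PolyMatrix.

(** * The syzygy theorem for Laurent polynomial rings *)

Section Localization.
Context (C B : comNzRingType) (j : {rmorphism C -> B}) (x : C) (y : B).
Context (jxy : j x * y = 1) (j_inj : injective j).
Context (frac : forall b : B, exists n c, j x ^+ n * b = j c).

Let jxn n : y ^+ n * j x ^+ n = 1.
Proof. by rewrite -exprMn mulrC jxy expr1n. Qed.

Let jxnK n p q (M N : 'M[B]_(p, q)) : j x ^+ n *: M = N -> M = y ^+ n *: N.
Proof. by move<-; rewrite scalerA jxn scale1r. Qed.

Lemma frac_mx p q (M : 'M[B]_(p, q)) :
  exists n M', j x ^+ n *: M = map_mx j M'.
Proof.
have /choice[f /choice[c hc]] (i : 'I_p * 'I_q) := frac (M i.1 i.2).
pose n := (\max_i f i)%N.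
exists n, (\matrix_(a, b) (x ^+ (n - f (a, b)) * c (a, b))).
apply/matrixP => a b; rewrite !mxE rmorphM rmorphXn -(hc (a, b)) mulrA -exprD.
by rewrite subnK // (leq_bigmax (a, b)).
Qed.

Lemma noetherian_loc : noetherian C -> noetherian B.
Proof.
move=> noethC n N sN.
have [|m [F hF]] := noethC n (fun v => N (map_mx j v)).
  split=> [|r u v Nu Nv]; first by rewrite map_mx0; case: sN.
  by rewrite map_mxD map_mxZ; apply: sub_add => //; apply: sub_scale.
exists m, (map_mx j F) => v; split=> [Nv|[u ->]].
  have [k [v' hv]] := frac_mx v.
  have /hF[u hu] : N (map_mx j v') by rewrite -hv; apply: sub_scale.
  exists (y ^+ k *: map_mx j u).
  by rewrite -scalemxAr -map_mxM -hu; apply: jxnK.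
apply: sub_mulmx => // i; rewrite -map_col; apply/hF.
by exists (delta_mx i 0); rewrite colE.
Qed.

Let map_j_eq0 p q (M : 'M[C]_(p, q)) : map_mx j M = 0 -> M = 0.
Proof.
move=> /matrixP h; apply/matrixP => a b; apply: j_inj.
by have := h a b; rewrite !mxE rmorph0.
Qed.

(** Localization is exact: a power of the unit [j x] moves a kernel vector into [C], where exactness
    applies, and [y] undoes the power. *)
Lemma ffr_map_loc q a (F : 'M[C]_(q, a)) : ffr F -> ffr (map_mx j F).
Proof.
have eq0 r b (G : 'M[C]_(r, b)) (v : 'cV[B]_b) k v' :
    j x ^+ k *: v = map_mx j v' -> map_mx j G *m v = 0 -> G *m v' = 0.
  by move=> hv Gv; apply: map_j_eq0; rewrite map_mxM -hv -scalemxAr Gv scaler0.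
case=> n; elim: n q a F => [|n IH] q a F /=.
  move=> injF; apply: ffr_mxinj => v Fv; have [k [v' hv]] := frac_mx v.
  rewrite (jxnK hv); have /injF -> := eq0 _ _ _ _ _ _ hv Fv.
  by rewrite map_mx0 scaler0.
case=> b [G [exG /IH fG]]; apply: ffr_step fG => v.
split=> [Fv|[u ->]]; last by rewrite mulmxA -map_mxM (mxexact_mul0 exG) map_mx0 mul0mx.
have [k [v' hv]] := frac_mx v; have /exG[u hu] := eq0 _ _ _ _ _ _ hv Fv.
by exists (y ^+ k *: map_mx j u); rewrite -scalemxAr -map_mxM -hu; apply: jxnK.
Qed.

Lemma ffr_loc :
  (forall q a (F : 'M[C]_(q, a)), ffr F) -> forall q a (F : 'M[B]_(q, a)), ffr F.
Proof.
move=> ffrC q a F; have [n [F' hF]] := frac_mx F.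
apply: ffr_ker (ffr_map_loc (ffrC _ _ F')) => u.
rewrite -hF -scalemxAl; split=> [/jxnK ->|->]; by rewrite scaler0.
Qed.
End Localization.

Section Field.
Context (F : fieldType).

(** A matrix of maximal rank among those with rows in [N] spans [N], since appending a vector of [N]
    cannot raise the rank. *)
Lemma noetherian_field : noetherian F.
Proof.
move=> n N sN.
pose P r := `[< exists m (G : 'M[F]_(m, n)),
  (forall i, N (row i G)^T) /\ \rank G = r >].
have exP : exists r, P r.
  exists 0%N; apply/asboolP; exists 0%N, 0; split=> [[]//|].
  by rewrite mxrank0.
have ubP r : P r -> (r <= n)%N.
  by move=> /asboolP[m [G [_ <-]]]; apply: rank_leq_col.
case: (ex_maxnP exP ubP) => r /asboolP[m [G [NG <-]]] maxG.
exists m, G^T => v; split=> [Nv|[u ->]]; last first.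
  by apply: sub_mulmx => // i; rewrite -tr_row.
have /submxP[w hw] : (v^T <= G)%MS.
  have : (\rank (col_mx v^T G) <= \rank G)%N.
    apply: maxG; apply/asboolP; exists (1 + m)%N, (col_mx v^T G); split=> // i.
    case: (split_ordP i) => k ->; last by rewrite rowKd.
    by rewrite rowKu row_id ?trmxK // ord1.
  rewrite -addsmxE => le_rk.
  rewrite (geq_leqif (mxrank_leqif_sup (addsmxSr v^T G))) in le_rk.
  by apply: submx_trans le_rk; apply: addsmxSl.
by exists w^T; rewrite -trmx_mul -hw trmxK.
Qed.

Lemma ffr_field q a (A : 'M[F]_(q, a)) : ffr A.
Proof.
apply: (ffr_step (B := (row_base (kermx A^T))^T)) => [v|].
  have -> : A *m v = 0 <-> (v^T <= kermx A^T)%MS.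
    split=> [h|/sub_kermxP h]; first by apply/sub_kermxP; rewrite -trmx_mul h trmx0.
    by apply: trmx_inj; rewrite trmx_mul h trmx0.
  split.
    move=> h; have /submxP[w hw] : (v^T <= row_base (kermx A^T))%MS by rewrite eq_row_base.
    by exists w^T; rewrite -trmx_mul -hw trmxK.
  by case=> u ->; rewrite trmx_mul trmxK -(eq_row_base (kermx A^T)) submxMl.
apply: ffr_mxinj => v /(congr1 trmx); rewrite trmx_mul trmxK trmx0 => h.
apply: trmx_inj; rewrite trmx0.
by apply: (row_free_inj (row_base_free (kermx A^T))); rewrite h mul0mx.
Qed.
End Field.

Section Laurent.
Context (k : fieldType).

Definition galg_C (G : zmodType) (c : k) : galg k G := << c *g 0 >>.

Lemma galg_mulE (G : zmodType) (a b : k) (u v : G) :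
  (<< a *g u >> : galg k G) * << b *g v >> = << a * b *g (u + v)%R >>.
Proof. exact: galg_mulUU. Qed.

Lemma galg_C_zmod G : zmod_morphism (@galg_C G).
Proof. by move=> a b; rewrite /galg_C monalgUB. Qed.

Lemma galg_C_monoid G : monoid_morphism (@galg_C G).
Proof. by split=> // a b; rewrite /galg_C galg_mulE addr0. Qed.

HB.instance Definition _ G :=
  GRing.isZmodMorphism.Build k (galg k G) (@galg_C G) (@galg_C_zmod G).
HB.instance Definition _ G :=
  GRing.isMonoidMorphism.Build k (galg k G) (@galg_C G) (@galg_C_monoid G).


Lemma galg_C_inj G : injective (@galg_C G).
Proof. by move=> a b /malgP/(_ 0); rewrite !mcoeffUU. Qed.

Lemma galg_X_exp (G : zmodType) (u : G) n : galg_X k u ^+ n = galg_X k (u *+ n).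
Proof.
elim: n => [//|n IH].
by rewrite exprS IH /galg_X galg_mulE mulr1 mulrS.
Qed.

Lemma mcoeff_mulX (G : zmodType) (g : galg k G) (u v : G) :
  (g * galg_X k u)@_v = g@_(v - u).
Proof.
elim/galg_elim: g => [|g g' IH IH'|a w].
- by rewrite mul0r !mcoeff0.
- by rewrite mulrDl !mcoeffD IH IH'.
by rewrite /galg_X galg_mulE !mcoeffU mulr1 eq_sym -subr_eq eq_sym.
Qed.

Section Step.
Context (D : nat).
Local Notation A := (galg k 'rV[int]_D).
Local Notation B := (galg k 'rV[int]_(1 + D)).

Definition emb (z : int) (u : 'rV[int]_D) : 'rV[int]_(1 + D) := row_mx z%:M u.

Lemma embD z z' u u' : emb (z + z') (u + u') = emb z u + emb z' u'.
Proof. by rewrite /emb raddfD /= add_row_mx. Qed.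

Lemma emb_eq z z' u u' : (emb z u == emb z' u') = (z == z') && (u == u').
Proof.
apply/eqP/andP => [/eq_row_mx[/matrixP/(_ 0 0)]|[/eqP-> /eqP->//]].
by rewrite !mxE !mulr1n => -> ->.
Qed.

Lemma embE v : exists z u, v = emb z u.
Proof.
by exists (lsubmx v 0 0), (rsubmx v); rewrite /emb -mx11_scalar hsubmxK.
Qed.

Definition galg_lift : A -> B :=
  locked (fun g : A => \sum_(u <- msupp g) << g@_u *g emb 0 u >> : B).

Lemma mcoeff_lift g z u : (galg_lift g)@_(emb z u) = if z == 0 then g@_u else 0.
Proof.
rewrite /galg_lift -lock raddf_sum /=; case: (eqVneq z 0) => [->|z0]; last first.
  by rewrite big1 // => v _; rewrite mcoeffU emb_eq eq_sym (negPf z0).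
have [hu|hu] := boolP (u \in msupp g).
  rewrite (big_fsetD1 _ hu) /= mcoeffU eqxx mulr1n big1_fset ?addr0 //.
  by move=> v; rewrite in_fsetD1 mcoeffU emb_eq eqxx /= => /andP[/negPf-> _] _.
rewrite (mcoeff_outdom hu) big1_fset // => v hv _.
by rewrite mcoeffU emb_eq eqxx /=; case: eqP hv hu => // -> ->.
Qed.

Lemma galg_lift_zmod : zmod_morphism galg_lift.
Proof.
move=> g g'; apply/malgP => v; have [z [u ->]] := embE v.
rewrite [RHS]mcoeffB [LHS]mcoeff_lift [in RHS](mcoeff_lift g).
rewrite [in RHS](mcoeff_lift g') [X in if _ then X else _]mcoeffB.
by case: eqP => _; rewrite ?subr0.
Qed.

HB.instance Definition _ :=
  GRing.isZmodMorphism.Build A B galg_lift galg_lift_zmod.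

Lemma galg_liftU a u : galg_lift << a *g u >> = << a *g emb 0 u >>.
Proof.
apply/malgP => v; have [z [w ->]] := embE v.
rewrite mcoeff_lift !mcoeffU emb_eq eq_sym.
by case: eqP => //=; rewrite mulr0n.
Qed.

Lemma galg_lift0 : galg_lift 0 = 0.
Proof. exact: raddf0. Qed.

Lemma galg_liftD g g' : galg_lift (g + g') = galg_lift g + galg_lift g'.
Proof. exact: raddfD. Qed.

Lemma galg_lift_monoid : monoid_morphism galg_lift.
Proof.
split=> [|g1 g2]; first by rewrite galg_liftU /emb raddf0 row_mx0.
elim/galg_elim: g1 => [|g g' IH IH'|a u].
- by rewrite mul0r galg_lift0 mul0r.
- rewrite mulrDl (galg_liftD (g * g2)) (galg_liftD g) mulrDl.
  exact: (congr2 +%R IH IH').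
elim/galg_elim: g2 => [|g g' IH IH'|b v].
- by rewrite mulr0 galg_lift0 mulr0.
- rewrite mulrDr (galg_liftD (_ * g)) (galg_liftD g) mulrDr.
  exact: (congr2 +%R IH IH').
rewrite galg_mulE (galg_liftU a u) (galg_liftU b v) galg_mulE -embD addr0.
exact: galg_liftU.
Qed.

HB.instance Definition _ :=
  GRing.isMonoidMorphism.Build A B galg_lift galg_lift_monoid.

Definition laurent_X : B := galg_X k (emb 1 0).

Lemma laurent_X_exp n : laurent_X ^+ n = galg_X k (emb n 0).
Proof.
rewrite galg_X_exp; congr galg_X; elim: n => [|n IH].
  by rewrite mulr0n /emb raddf0 row_mx0.
by rewrite mulrS IH -embD addr0 intS.
Qed.

Lemma laurent_commr : commr_rmorph galg_lift laurent_X.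
Proof. by move=> g; apply: mulrC. Qed.

Definition poly_laurent : {rmorphism {poly A} -> B} := horner_morph laurent_commr.

Lemma poly_laurentX : poly_laurent 'X = laurent_X.
Proof. by rewrite /poly_laurent /= /horner_morph map_polyX hornerX. Qed.

Lemma poly_laurentC g : poly_laurent g%:P = galg_lift g.
Proof. by rewrite /poly_laurent /= /horner_morph map_polyC hornerC. Qed.

Lemma mcoeff_poly_laurent p (n : nat) u : (poly_laurent p)@_(emb n u) = p`_n@_u.
Proof.
rewrite -{1}(coefK p) poly_def !raddf_sum /=.
transitivity (\sum_(i < size p) if i == n :> nat then p`_i@_u else 0).
  apply: eq_bigr => i _; rewrite -mul_polyC rmorphM rmorphXn /=.
  rewrite -/poly_laurent poly_laurentC poly_laurentX laurent_X_exp mcoeff_mulX.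
  have -> : emb n u - emb i 0 = emb (n%:Z - i%:Z) u.
    by apply/eqP; rewrite subr_eq -embD addr0 subrK.
  by rewrite mcoeff_lift subr_eq0 eqz_nat eq_sym.
have [lt_n|le_n] := ltnP n (size p).
  rewrite (bigD1 (Ordinal lt_n)) //= eqxx big1 ?addr0 // => i.
  by rewrite -val_eqE /= => /negPf->.
rewrite nth_default // mcoeff0 big1 // => i _; case: eqP => // ni.
by have := ltn_ord i; rewrite ni ltnNge le_n.
Qed.

Lemma poly_laurent_inj : injective poly_laurent.
Proof.
move=> p q /malgP h; apply/polyP => n; apply/malgP => u.
by have := h (emb n u); rewrite !mcoeff_poly_laurent.
Qed.

Lemma poly_laurent_frac b :
  exists n c, poly_laurent 'X ^+ n * b = poly_laurent c.
Proof.
elim/galg_elim: b => [|b b' [n [c hc]] [n' [c' hc']]|a v].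
- by exists 0%N, 0; rewrite mulr0 raddf0.
- exists (n + n')%N, ('X^n' * c + 'X^n * c').
  rewrite mulrDr rmorphD !rmorphM !rmorphXn -hc -hc' !mulrA -!exprD.
  by rewrite [(n' + n)%N]addnC.
have [z [u ->]] := embE v.
suff [n [m hnm]] : exists n m : nat, n%:Z + z = m%:Z.
  exists n, ((<< a *g u >> : A)%:P * 'X^m); rewrite rmorphM rmorphXn poly_laurentC.
  rewrite poly_laurentX galg_liftU !laurent_X_exp /galg_X !galg_mulE -!embD.
  by rewrite mul1r mulr1 hnm !add0r addr0.
case: z => m; first by exists 0%N, m; rewrite add0r.
by exists m.+1, 0%N; rewrite NegzE subrr.
Qed.

(** The ring in 1 + D variables is [{poly A}] with its variable inverted, so each property passes
    first to polynomials and then to a localization. *)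
Lemma laurent_step :
    noetherian A /\ (forall q a (F : 'M[A]_(q, a)), ffr F) ->
  noetherian B /\ (forall q a (F : 'M[B]_(q, a)), ffr F).
Proof.
have Xunit : poly_laurent 'X * galg_X k (emb (-1) 0) = 1.
  rewrite poly_laurentX /laurent_X /galg_X galg_mulE mulr1 -embD subrr addr0.
  by rewrite /emb raddf0 row_mx0.
case=> noethA ffrA; split.
  exact: noetherian_loc Xunit poly_laurent_frac (noetherian_poly noethA).
apply: ffr_loc Xunit poly_laurent_inj poly_laurent_frac _.
exact: ffr_poly.
Qed.
End Step.

Lemma laurent_ffr D :
  noetherian (galg k 'rV[int]_D) /\
  (forall q a (F : 'M[galg k 'rV[int]_D]_(q, a)), ffr F).
Proof.
elim: D => [|D IH]; last exact: laurent_step.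
(* For D = 0 the group is trivial and the ring is [k]; this isomorphism is treated as the
   localization of [k] at 1. *)
have unit1 : galg_C 'rV[int]_0 1 * 1 = 1 by rewrite rmorph1 mulr1.
have frac (b : galg k 'rV[int]_0) :
    exists n c, galg_C 'rV[int]_0 1 ^+ n * b = galg_C 'rV[int]_0 c.
  exists 0%N, (b@_0); rewrite expr0 mul1r; apply/malgP => u.
  by rewrite thinmx0 mcoeffUU.
split; first exact: noetherian_loc unit1 frac (@noetherian_field k).
exact: ffr_loc unit1 (@galg_C_inj _) frac (@ffr_field k).
Qed.
End Laurent.

(** * Ext from an arbitrary projective resolution *)

Section Projective.
Context (R : comNzRingType).

(** [g] need not be surjective, only its image must contain that of [f]. Exactness at a term then
    applies directly, without restricting codomains. *)
Definition projective (P : lmodType R) : Prop :=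
  forall (X Y : lmodType R) (g : {linear X -> Y}) (f : {linear P -> Y}),
    (forall p, exists x, f p = g x) ->
  exists h : {linear P -> X}, forall p, f p = g (h p).

Lemma projective_malg (S : choiceType) : projective {malg R[S]}.
Proof.
move=> X Y g f im_f; have /choice[x hx] := fun s : S => im_f << s >>.
pose h0 (m : {malg R[S]}) := \sum_(s <- msupp m) m@_s *: x s.
have h0w (d : {fset S}) m : (msupp m `<=` d)%fset -> h0 m = \sum_(s <- d) m@_s *: x s.
  move=> le_d; rewrite /h0 (big_fset_incl _ le_d) //= => s _ /mcoeff_outdom ->.
  by rewrite scale0r.
have h0_lin : linear h0.
  move=> r m n; pose d := (msupp m `|` msupp n `|` msupp (r *: m + n))%fset.
  have dm : (msupp m `<=` d)%fset by rewrite /d -fsetUA fsubsetUl.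
  have dn : (msupp n `<=` d)%fset by rewrite /d fsetUAC fsubsetUr.
  have dmn : (msupp (r *: m + n) `<=` d)%fset by rewrite /d fsubsetUr.
  rewrite (h0w _ _ dm) (h0w _ _ dn) (h0w _ _ dmn).
  rewrite scaler_sumr -big_split /=; apply: eq_bigr => s _.
  by rewrite mcoeffD mcoeffZ scalerDl scalerA.
pose hM := GRing.isLinear.Build R {malg R[S]} X _ h0 h0_lin.
pose h : {linear {malg R[S]} -> X} := HB.pack h0 hM.
have mZ (a : R) (s : S) : << a *g s >> = a *: << s >> :> {malg R[S]}.
  by apply/malgP => t; rewrite mcoeffZ !mcoeffU mulrnAr mulr1.
exists h => m; rewrite {1}(monalgE m) (raddf_sum f) (raddf_sum g (msupp m)) /=.
by apply/eq_bigr => s _; rewrite mZ !linearZ /= hx.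
Qed.

Lemma projective_cV n : projective 'cV[R]_n.
Proof.
move=> X Y g f im_f.
have /choice[x hx] := fun i : 'I_n => im_f (delta_mx i 0).
pose h0 (v : 'cV[R]_n) := \sum_i v i 0 *: x i.
have h0_lin : linear h0.
  move=> r u v; rewrite scaler_sumr -big_split /=; apply: eq_bigr => s _.
  by rewrite !mxE scalerDl scalerA.
pose hM := GRing.isLinear.Build R 'cV[R]_n X _ h0 h0_lin.
pose h : {linear 'cV[R]_n -> X} := HB.pack h0 hM.
have vE (v : 'cV[R]_n) : v = \sum_i v i 0 *: delta_mx i 0.
  by rewrite {1}(matrix_sum_delta v); apply: eq_bigr => i _; rewrite big_ord1.
exists h => v; rewrite {1}(vE v) (raddf_sum f) (raddf_sum g) /=.
by apply/eq_bigr => i _; rewrite !linearZ /= hx.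
Qed.

Definition resolution (M : lmodType R) (P : nat -> lmodType R)
    (d : forall n, {linear P n.+1 -> P n}) (e : {linear P 0 -> M}) : Prop :=
  [/\ forall m, exists x, m = e x,
      forall y, e y = 0 <-> exists x, y = d 0 x &
      forall n y, d n y = 0 <-> exists x, y = d n.+1 x].

Section Lifts.
Context (P Q : nat -> lmodType R) (M : lmodType R).
Context (dP : forall n, {linear P n.+1 -> P n}) (eP : {linear P 0 -> M}).
Context (dQ : forall n, {linear Q n.+1 -> Q n}) (eQ : {linear Q 0 -> M}).

(* [chain_lift s n f]: f is the degree n component of a partial chain map P -> Q
   over the identity of M if s is true, over 0 otherwise *)
Fixpoint chain_lift (s : bool) (n : nat) : {linear P n -> Q n} -> Prop :=
  match n with
  | 0 => fun f => forall x, eQ (f x) = if s then eP x else 0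
  | n'.+1 => fun f => exists2 f' : {linear P n' -> Q n'},
      chain_lift s f' & forall x, dQ n' (f x) = f' (dP n' x)
  end.

Hypothesis (projP : forall n, projective (P n)).
Hypothesis (resP : resolution dP eP) (resQ : resolution dQ eQ).

(** One degree of the comparison theorem. Only finitely many components are ever needed, so no
    infinite chain map has to be chosen. *)
Lemma chain_liftS n (f : {linear P n -> Q n}) : chain_lift true f ->
  exists2 f1 : {linear P n.+1 -> Q n.+1},
    chain_lift true f1 & forall x, dQ n (f1 x) = f (dP n x).
Proof.
case: resP resQ => _ exP0 exP [_ exQ0 exQ] lf.
have [x|f1 hf1] := @projP n.+1 _ _ (dQ n) (f \o dP n : {linear P n.+1 -> Q n}).
  case: n f lf x => [|n] f /=.
    move=> lf x; apply/exQ0; rewrite /= lf; apply/exP0; by exists x.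
  case=> f' _ hf x; apply/exQ; rewrite /= hf.
  have -> : dP n (dP n.+1 x) = 0 by apply/exP; exists x.
  by rewrite raddf0.
have {}hf1 x : dQ n (f1 x) = f (dP n x) by rewrite -hf1.
by exists f1; [exists f|].
Qed.

Lemma chain_lift_ex n : exists f : {linear P n -> Q n}, chain_lift true f.
Proof.
elim: n => [|n [f /chain_liftS[f1 l1 _]]]; last by exists f1.
case: resQ => surj _ _.
have [x|f hf] := @projP 0 _ _ eQ eP; first exact: surj.
by exists f => x; rewrite -hf.
Qed.

(** A lift of zero is null-homotopic. The homotopy is built degree by degree: the [t] of one degree
    is the [s] of the next, and [stop] is the common lifting step. *)
Lemma chain_lift0_homotopy n (f : {linear P n.+1 -> Q n.+1}) : chain_lift false f ->
  exists (s : {linear P n -> Q n.+1}) (t : {linear P n.+1 -> Q n.+2}),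
    forall x, f x = dQ n.+1 (t x) + s (dP n x).
Proof.
case: resP resQ => _ exP0 exP [_ exQ0 exQ].
have stop m (u : {linear P m.+1 -> Q m.+1}) (s : {linear P m -> Q m.+1}) :
    (forall x, dQ m (u x) = dQ m (s (dP m x))) ->
    exists t : {linear P m.+1 -> Q m.+2}, forall x, u x = dQ m.+1 (t x) + s (dP m x).
  move=> h.
  have [x|t ht] := @projP m.+1 _ _ (dQ m.+1)
      ((u \- (s \o dP m)) : {linear P m.+1 -> Q m.+1}).
    by apply/exQ; rewrite /= linearB h subrr.
  by exists t => x; rewrite -ht /= subrK.
elim: n f => [|n IH] f [f' lf' hf].
  have [x|s hs] := @projP 0 _ _ (dQ 0) f'; first by apply/exQ0/lf'.
  have [|t ht] := stop 0 f s; first by move=> x; rewrite hf hs.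
  by exists s, t.
have [s [t hst]] := IH _ lf'.
have [|t' ht'] := stop n.+1 f t; last by exists t, t'.
move=> x; rewrite hf hst.
have -> : dP n (dP n.+1 x) = 0 by apply/exP; exists x.
by rewrite raddf0 addr0.
Qed.
End Lifts.
End Projective.

Section LiftAlgebra.
Context (R : comNzRingType) (M : lmodType R) (P Q : nat -> lmodType R).
Context (dP : forall n, {linear P n.+1 -> P n}) (eP : {linear P 0 -> M}).
Context (dQ : forall n, {linear Q n.+1 -> Q n}) (eQ : {linear Q 0 -> M}).

Lemma chain_lift_retract n (f : {linear P n -> Q n}) (g : {linear Q n -> P n}) :
  chain_lift dP eP dQ eQ true f -> chain_lift dQ eQ dP eP true g ->
  chain_lift dP eP dP eP false (idfun \- (g \o f) : {linear P n -> P n}).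
Proof.
elim: n f g => [|n IH] f g /=; first by move=> hf hg x; rewrite linearB /= hg hf subrr.
case=> f' lf hf [g' lg hg]; exists (idfun \- (g' \o f')); first exact: IH.
by move=> x; rewrite /= linearB /= hg hf.
Qed.
End LiftAlgebra.

Lemma cokproj_eq0 (R : comNzRingType) (M N : lmodType R) (f : {linear M -> N}) x :
  cokproj f x = 0 <-> exists z, x = f z.
Proof.
rewrite -[0](raddf0 (cokproj f)); split=> [/cokproj_eq|] [z hz].
  by exists z; rewrite -hz subr0.
by apply/cokproj_eq; exists z; rewrite subr0.
Qed.

Section ExtResolution.
Context (R : comNzRingType) (M N : lmodType R).
Context (P : nat -> lmodType R) (d : forall n, {linear P n.+1 -> P n}).
Context (e : {linear P 0 -> M}).
Context (projP : forall n, projective (P n)) (resP : resolution d e).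

Lemma res_resolution : resolution (@res_d R M) (@aug R M).
Proof.
split=> [m|y|n y].
- by have [x hx] := aug_surj m; exists x.
- by rewrite res_exact0; split=> -[x hx]; exists x.
- by rewrite res_exactS; split=> -[x hx]; exists x.
Qed.

Lemma res_projective n : projective (res M n).
Proof. exact: projective_malg. Qed.

(** Independence of Ext from the resolution, stated as a surjection from cocycles whose kernel is
    the coboundaries. The map is pullback along a comparison map [g]; with [f] in the other
    direction, the homotopy of [f \o g] to the identity gives surjectivity and that of [g \o f]
    gives the kernel. *)
Lemma Ext_resolution n :
  exists c : {linear kermod (@precomp R _ _ N (d n.+1)) -> Ext M N n.+1},
    (forall y, exists x, y = c x) /\
    forall x, c x = 0 <-> exists h : {linear P n -> N},
      forall p, val x p = h (d n p).
Proof.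
have [g0 lg0] := chain_lift_ex (@res_projective) res_resolution resP n.
have [g lg hg] := chain_liftS (@res_projective) res_resolution resP lg0.
(* The next degree, here and for [f2], is what makes the pullback of a cocycle a cocycle. *)
have [g2 _ hg2] := chain_liftS (@res_projective) res_resolution resP lg.
have [f0 lf0] := chain_lift_ex projP resP res_resolution n.
have [f lf hf] := chain_liftS projP resP res_resolution lf0.
have [f2 _ hf2] := chain_liftS projP resP res_resolution lf.
pose K := kermod (@precomp R _ _ N (d n.+1)).
have cocycle (x : K) p : val x (d n.+1 p) = 0.
  by have /eqP/(congr1 (fun u : {linear _ -> _} => u p)) := valP x.
have pullP (x : K) : ker_pred (delta M N n.+1) (val x \o g : {linear _ -> _}).
  by apply/eqP/homP => p /=; rewrite -hg2 cocycle.
pose pull x : kermod (delta M N n.+1) := Sub _ (pullP x).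
have pull_lin : linear pull.
  by move=> r x y; apply: val_inj; apply: homP.
pose pM := GRing.isLinear.Build R K (kermod (delta M N n.+1)) _ pull pull_lin.
pose pullL : {linear K -> kermod (delta M N n.+1)} := HB.pack pull pM.
exists (@cokproj R _ _ (corestr (@delta_delta R M N n)) \o pullL); split.
  move=> y; have [z <-] : exists z, @cokproj _ _ _ (corestr (@delta_delta R M N n)) z = y.
    by exists (repr y); apply: cokprojK.
  have zcoc q : val z (res_d q) = 0.
    by have /eqP/(congr1 (fun u : {linear _ -> _} => u q)) := valP z.
  have kz : ker_pred (@precomp R _ _ N (d n.+1)) (val z \o f : {linear _ -> _}).
    by apply/eqP/homP => p /=; rewrite -hf2 zcoc.
  exists (Sub _ kz : K) => /=; apply/cokproj_eq.
  have [s [t hst]] := chain_lift0_homotopy (@res_projective) res_resolution res_resolution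
    (chain_lift_retract lg lf).
  exists (val z \o s : {linear res M n -> N}).
  apply: val_inj; apply: homP => q /=.
  have := hst q => /(congr1 (val z)) /=.
  by rewrite linearB linearD /= zcoc add0r => <-.
move=> x; split=> /= [|[h hx]]; last first.
  apply: (proj2 (@cokproj_eq0 R _ _ (corestr (@delta_delta R M N n)) (pull x))).
  exists (h \o g0 : {linear res M n -> N}); apply: val_inj; apply: homP => q /=.
  by rewrite hx hg.
move/(proj1 (@cokproj_eq0 R _ _ (corestr (@delta_delta R M N n)) (pull x))).
case=> h /(congr1 val) /=.
move=> /(congr1 (fun u : {linear _ -> _} => fun q => u q)) /= hq.
have {}hq q : val x (g q) = h (res_d q) by have := congr1 (fun u => u q) hq.
have [s [t hst]] := chain_lift0_homotopy projP resP resP (chain_lift_retract lf lg).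
exists ((h \o f0) \+ (val x \o s)) => p /=.
have := hst p => /(congr1 (val x)) /=.
rewrite linearB linearD /= cocycle add0r hq => /eqP; rewrite subr_eq => /eqP ->.
by rewrite addrC hf.
Qed.
End ExtResolution.

(** * Stable equivalence of matrices *)

Section MatrixResolution.
Context (R : comNzRingType).

Lemma cV_sum_delta n (v : 'cV[R]_n) : v = \sum_i v i 0 *: delta_mx i 0.
Proof.
by rewrite {1}(matrix_sum_delta v); apply: eq_bigr => i _; rewrite big_ord1.
Qed.

Lemma linear_cV n m (h : {linear 'cV[R]_n -> 'cV[R]_m}) :
  exists X, forall v, h v = X *m v.
Proof.
exists (\matrix_(i, j) h (delta_mx j 0) i 0) => v.
rewrite {1}(cV_sum_delta v) (raddf_sum h) /=; apply/matrixP => i j.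
rewrite summxE mxE; apply: eq_bigr => l _.
by rewrite linearZ /= !mxE ord1 mulrC.
Qed.

Lemma ffr_sequence q a (A : 'M[R]_(q, a)) : ffr A ->
  exists (nn : nat -> nat) (d : forall n, 'M[R]_(nn n, nn n.+1))
         (eq : nn 0 = q) (ea : nn 1 = a),
    [/\ castmx (eq, ea) (d 0) = A,
        forall n, mxexact (d n.+1) (d n) &
        exists L, forall n, (L <= n)%N -> nn n = 0].
Proof.
case=> n; elim: n q a A => [|n IH] q a A /=.
  move=> injA.
  pose nn i := if i is i'.+1 then if i' is 0 then a else 0%N else q.
  pose d i : 'M[R]_(nn i, nn i.+1) := if i is 0 then A else 0.
  exists nn, d, erefl, erefl; split; first by rewrite castmx_id.
    case=> [|[|i]] v; first exact: mxexact0.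
      split=> [_|_]; last exact: mul0mx.
      by exists 0; apply/matrixP => -[].
    split=> [_|_]; last exact: mul0mx.
    by exists 0; apply/matrixP => -[].
  by exists 2%N; case=> [|[]].
case=> b [B [exB /IH[nn [d [eq [ea [dB exd [L hL]]]]]]]].
case: a / eq A B exB dB => A B; case: b / ea B => B.
rewrite castmx_id => exB dB; subst B.
pose nn' i := if i is i'.+1 then nn i' else q.
pose d' i : 'M[R]_(nn' i, nn' i.+1) := if i is i'.+1 then d i' else A.
exists nn', d', erefl, erefl; split; first by rewrite castmx_id.
  by case.
by exists L.+1; case=> // i; apply: hL.
Qed.

Section ExtMatrix.
Context (M : lmodType R) (nn : nat -> nat).
Context (d : forall n, 'M[R]_(nn n, nn n.+1)) (e : {linear 'cV[R]_(nn 0) -> M}).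
Local Notation dmap n := (mulmx (d n) : {linear 'cV[R]_(nn n.+1) -> 'cV[R]_(nn n)}).
Context (res_d : resolution (P := fun n => 'cV[R]_(nn n)) (fun n => dmap n) e).
Local Notation D n := (mulmx (d n)^T : {linear 'cV[R]_(nn n) -> 'cV[R]_(nn n.+1)}).

(** The pairing that identifies a free module with its dual; precomposition with [mulmx A] becomes
    multiplication by [A^T]. *)
Definition functional m (v : 'cV[R]_m) (w : 'cV[R]_m) : R^o := (v^T *m w) 0 0.

Lemma functional_is_linear m (v : 'cV[R]_m) : linear (functional v).
Proof. by move=> r w w'; rewrite /functional linearP !mxE. Qed.

HB.instance Definition _ m v :=
  GRing.isLinear.Build R 'cV[R]_m R^o _ (@functional m v) (functional_is_linear v).

Lemma functionalP m (h : {linear 'cV[R]_m -> R^o}) : exists v, h =1 functional v.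
Proof.
exists (\col_i h (delta_mx i 0)) => w; rewrite {1}(cV_sum_delta w) (raddf_sum h) /=.
rewrite /functional mxE; apply: eq_bigr => i _.
by rewrite linearZ /= !mxE mulrC.
Qed.

Lemma functional_inj m (v v' : 'cV[R]_m) : functional v =1 functional v' -> v = v'.
Proof.
move=> h; apply/matrixP => i j; have := h (delta_mx i 0).
by rewrite /functional -!colE !mxE ord1.
Qed.

Lemma functional_mul m p (A : 'M[R]_(m, p)) v w :
  functional v (A *m w) = functional (A^T *m v) w.
Proof. by rewrite /functional trmx_mul trmxK mulmxA. Qed.

Lemma Ext_matrix n :
  exists c : {linear kermod (D n.+1) -> Ext M R^o n.+1},
    (forall y, exists x, y = c x) /\
    forall x, c x = 0 <-> im_mx (d n)^T (val x).
Proof.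
have [c [surj kerc]] :=
  Ext_resolution R^o (fun n => @projective_cV R (nn n)) res_d n.
pose K := kermod (@precomp R _ _ R^o (dmap n.+1)).
have toP (x : kermod (D n.+1)) :
    ker_pred (@precomp R _ _ R^o (dmap n.+1)) (functional (val x) : {linear _ -> _}).
  apply/eqP/homP => w; rewrite /= functional_mul.
  by have /eqP -> := valP x; rewrite /functional trmx0 mul0mx mxE.
pose to x : K := Sub _ (toP x).
have to_lin : linear to.
  move=> r x y; apply: val_inj; apply: homP => w.
  by rewrite /= /functional linearP mulmxDl -scalemxAl !mxE.
pose toM := GRing.isLinear.Build R (kermod (D n.+1)) K _ to to_lin.
pose toL : {linear kermod (D n.+1) -> K} := HB.pack to toM.
exists (c \o toL); split=> [y|x].
  have [z ->] := surj y; have [v hv] := functionalP (val z).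
  have kv : ker_pred (D n.+1) v.
    apply/eqP; apply: functional_inj => w; rewrite /= -functional_mul -hv.
    have /eqP/(congr1 (fun u : {linear _ -> _} => u w)) /= -> := valP z.
    by rewrite /functional trmx0 mul0mx mxE.
  exists (Sub v kv) => /=; congr (c _); apply: val_inj; exact: homP.
rewrite /= kerc; split=> [[h hh]|[u hu]].
  have [u hu] := functionalP h; exists u; apply: functional_inj => w.
  by rewrite -functional_mul -hu -hh.
exists (functional u : {linear _ -> _}) => w /=.
by rewrite functional_mul -hu.
Qed.

Lemma Ext_exact n :
  trivial_mod (Ext M R^o n.+1) -> mxexact (d n)^T (d n.+1)^T.
Proof.
move=> tr v; have [c [_ kerc]] := Ext_matrix n; split=> [Dv|[u ->]].
  have kv : ker_pred (D n.+1) v by apply/eqP.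
  by have /kerc := tr (c (Sub v kv)).
rewrite mulmxA -trmx_mul; case: res_d => _ _ ex.
by rewrite (mxexact_mul0 (ex n)) trmx0 mul0mx.
Qed.
End ExtMatrix.

(* X and X' induce isomorphisms between the cokernels of A and A' in the stable
   module category, where maps that factor through a free module vanish: the
   condition on X' X says that X' X - 1 - A Z kills the image of A. *)
Definition stab_equiv q a q' a' (A : 'M[R]_(q, a)) (A' : 'M[R]_(q', a')) : Prop :=
  exists (X : 'M_(q', q)) (Y : 'M_(a', a)) (X' : 'M_(q, q')) (Y' : 'M_(a, a'))
         (Z : 'M_(a, q)) (Z' : 'M_(a', q')),
    [/\ X *m A = A' *m Y, X' *m A' = A *m Y',
        X' *m X *m A = A + A *m Z *m A &
        X *m X' *m A' = A' + A' *m Z' *m A'].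

(** The two intertwining relations give X' X A = A Y' Y, so the conditions are self-dual once X and
    Y' are exchanged, as are Y and X'. *)
Lemma stab_equiv_tr q a q' a' (A : 'M[R]_(q, a)) (A' : 'M[R]_(q', a')) :
  stab_equiv A A' -> stab_equiv A^T A'^T.
Proof.
case=> X [Y [X' [Y' [Z [Z' [h h' hZ hZ']]]]]].
exists Y'^T, X'^T, Y^T, X^T, Z^T, Z'^T; split.
- by rewrite -!trmx_mul h'.
- by rewrite -!trmx_mul h.
- have -> : Y^T *m Y'^T *m A^T = (X' *m X *m A)^T.
    by rewrite -!trmx_mul mulmxA -h' -[in LHS]mulmxA -h mulmxA.
  by rewrite hZ linearD /= !trmx_mul !mulmxA.
- have -> : Y'^T *m Y^T *m A'^T = (X *m X' *m A')^T.
    by rewrite -!trmx_mul mulmxA -h -[in LHS]mulmxA -h' mulmxA.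
  by rewrite hZ' linearD /= !trmx_mul !mulmxA.
Qed.

Lemma stab_equiv_map (s : {rmorphism R -> R}) q a q' a'
    (A : 'M[R]_(q, a)) (A' : 'M[R]_(q', a')) :
  stab_equiv A A' -> stab_equiv (map_mx s A) (map_mx s A').
Proof.
case=> X [Y [X' [Y' [Z [Z' [h h' hZ hZ']]]]]].
exists (map_mx s X), (map_mx s Y), (map_mx s X'), (map_mx s Y').
exists (map_mx s Z), (map_mx s Z').
by rewrite -!map_mxM -!map_mxD h h' hZ hZ'.
Qed.

(** Passage to syzygies. The condition on X' X A says that [A] kills Y' Y - 1 - Z A, which therefore
    factors through [B]; the factor [S] is the new [Z]. *)
Lemma stab_equiv_exact q a b q' a' b' (A : 'M[R]_(q, a)) (B : 'M[R]_(a, b))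
    (A' : 'M[R]_(q', a')) (B' : 'M[R]_(a', b')) :
  mxexact B A -> mxexact B' A' -> stab_equiv A A' -> stab_equiv B B'.
Proof.
move=> ex ex' [X [Y [X' [Y' [Z [Z' [h h' hZ hZ']]]]]]].
have AB := mxexact_mul0 ex; have AB' := mxexact_mul0 ex'.
have [V hV] : exists V, Y *m B = B' *m V.
  by apply: (mxexact_lift ex'); rewrite mulmxA -h -mulmxA AB mulmx0.
have [V' hV'] : exists V', Y' *m B' = B *m V'.
  by apply: (mxexact_lift ex); rewrite mulmxA -h' -mulmxA AB' mulmx0.
have [S hS] : exists S, Y' *m Y - 1%:M - Z *m A = B *m S.
  apply: (mxexact_lift ex); rewrite !mulmxBr mulmx1 !mulmxA -h'.
  rewrite -[X' *m A' *m Y]mulmxA -h mulmxA hZ.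
  by rewrite -addrA -opprD subrr.
have [S' hS'] : exists S', Y *m Y' - 1%:M - Z' *m A' = B' *m S'.
  apply: (mxexact_lift ex'); rewrite !mulmxBr mulmx1 !mulmxA -h.
  rewrite -[X *m A *m Y']mulmxA -h' mulmxA hZ'.
  by rewrite -addrA -opprD subrr.
exists Y, V, Y', V', S, S'; split=> //.
- rewrite -hS !mulmxBl mul1mx -[Z *m A *m B]mulmxA AB mulmx0 subr0.
  by rewrite addrC subrK.
- rewrite -hS' !mulmxBl mul1mx -[Z' *m A' *m B']mulmxA AB' mulmx0 subr0.
  by rewrite addrC subrK.
Qed.

(** A projection onto [ker N], so that [ker N] is a direct summand of the free module. *)
Definition ker_proj m p (N : 'M[R]_(p, m)) (e : 'M[R]_m) : Prop :=
  N *m e = 0 /\ forall v : 'cV_m, N *m v = 0 -> e *m v = v.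

Section CohomologyIso.
Context (m p : nat) (N : 'M[R]_(p, m)) (e : 'M[R]_m).
Context (m' p' : nat) (N' : 'M[R]_(p', m')).
Local Notation KN := (kermod (mulmx N : {linear 'cV[R]_m -> 'cV[R]_p})).
Local Notation KN' := (kermod (mulmx N' : {linear 'cV[R]_m' -> 'cV[R]_p'})).
Context (E E' : lmodType R) (c : {linear KN -> E}) (c' : {linear KN' -> E'}).
Context (f : {linear E -> E'}).
Context (surj' : forall y, exists x, y = c' x).

(** [ker N] is perhaps not free, so the lift is taken on all of ['cV[R]_m] after projecting by [e],
    which changes nothing on [ker N]. *)
Lemma cohomology_lift : ker_proj N e ->
  exists2 X : 'M[R]_(m', m), N' *m X = 0 &
    forall (x : KN) (y : KN'), val y = X *m val x -> c' y = f (c x).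
Proof.
case=> Ne eK.
have toP v : ker_pred (mulmx N : {linear 'cV[R]_m -> 'cV[R]_p}) (e *m v).
  by apply/eqP; rewrite /= mulmxA Ne mul0mx.
pose to v : KN := Sub _ (toP v).
have to_lin : linear to.
  by move=> a u v; apply: val_inj; rewrite /= linearP.
pose toM := GRing.isLinear.Build R 'cV[R]_m KN _ to to_lin.
pose toL : {linear 'cV[R]_m -> KN} := HB.pack to toM.
have [v|h hh] := @projective_cV R m _ _ c' (f \o c \o toL : {linear 'cV[R]_m -> E'}).
  exact: surj'.
have [X hX] := linear_cV (val \o h : {linear 'cV[R]_m -> 'cV[R]_m'}).
exists X.
  apply/matrixP => i j; have /eqP/matrixP/(_ i 0) := valP (h (delta_mx j 0)).
  by have /= -> := hX (delta_mx j 0); rewrite /= mulmxA -colE !mxE.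
move=> x y hy; have -> : y = h (val x).
  by apply: val_inj; rewrite hy; have /= -> := hX (val x).
rewrite -hh /=; congr (f (c _)); apply: val_inj => /=.
by apply: eK; have /eqP := valP x.
Qed.
End CohomologyIso.

Lemma cohomology_stab_equiv m r p m' r' p'
    (A : 'M[R]_(m, r)) (N : 'M[R]_(p, m)) (e : 'M[R]_m)
    (A' : 'M[R]_(m', r')) (N' : 'M[R]_(p', m')) (e' : 'M[R]_m')
    (E E' : lmodType R)
    (c : {linear kermod (mulmx N : {linear 'cV[R]_m -> 'cV[R]_p}) -> E})
    (c' : {linear kermod (mulmx N' : {linear 'cV[R]_m' -> 'cV[R]_p'}) -> E'}) :
    N *m A = 0 -> N' *m A' = 0 -> ker_proj N e -> ker_proj N' e' ->
    (forall y, exists x, y = c x) -> (forall y, exists x, y = c' x) ->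
    (forall x, c x = 0 <-> im_mx A (val x)) ->
    (forall x, c' x = 0 <-> im_mx A' (val x)) ->
  lmod_iso E E' -> stab_equiv A A'.
Proof.
move=> NA NA' pe pe' surj surj' kerc kerc' [f [g0 fK gK]].
have g_lin : linear g0 by apply: can2_linear fK gK.
pose gM := GRing.isLinear.Build R E' E _ g0 g_lin.
pose g : {linear E' -> E} := HB.pack g0 gM.
have half m1 r1 p1 m2 r2 p2 (A1 : 'M[R]_(m1, r1)) (N1 : 'M[R]_(p1, m1))
    (A2 : 'M[R]_(m2, r2)) (N2 : 'M[R]_(p2, m2)) (E1 E2 : lmodType R)
    (c1 : {linear kermod (mulmx N1 : {linear 'cV[R]_m1 -> 'cV[R]_p1}) -> E1})
    (c2 : {linear kermod (mulmx N2 : {linear 'cV[R]_m2 -> 'cV[R]_p2}) -> E2})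
    (h : {linear E1 -> E2}) (X : 'M[R]_(m2, m1)) :
    N1 *m A1 = 0 -> N2 *m X = 0 ->
    (forall x, c1 x = 0 <-> im_mx A1 (val x)) ->
    (forall x, c2 x = 0 <-> im_mx A2 (val x)) ->
    (forall x y, val y = X *m val x -> c2 y = h (c1 x)) ->
    exists Y, X *m A1 = A2 *m Y.
  move=> NA1 NX k1 k2 hX; apply: im_mx_lift => u.
  have kx : ker_pred (mulmx N1 : {linear 'cV[R]_m1 -> 'cV[R]_p1}) (A1 *m u).
    by apply/eqP; rewrite /= mulmxA NA1 mul0mx.
  have ky : ker_pred (mulmx N2 : {linear 'cV[R]_m2 -> 'cV[R]_p2}) (X *m A1 *m u).
    by apply/eqP; rewrite /= !mulmxA NX !mul0mx.
  apply: (proj1 (k2 (Sub _ ky))); rewrite (hX (Sub _ kx)) /= ?mulmxA //.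
  by rewrite (proj2 (k1 (Sub _ kx))) ?raddf0 //; exists u.
have roundtrip m1 r1 p1 m2 p2 (A1 : 'M[R]_(m1, r1)) (N1 : 'M[R]_(p1, m1)) e1
    (N2 : 'M[R]_(p2, m2)) (E1 E2 : lmodType R)
    (c1 : {linear kermod (mulmx N1 : {linear 'cV[R]_m1 -> 'cV[R]_p1}) -> E1})
    (c2 : {linear kermod (mulmx N2 : {linear 'cV[R]_m2 -> 'cV[R]_p2}) -> E2})
    (h : {linear E1 -> E2}) (h' : {linear E2 -> E1})
    (X : 'M[R]_(m2, m1)) (X' : 'M[R]_(m1, m2)) :
    cancel h h' -> ker_proj N1 e1 ->
    N1 *m A1 = 0 -> N2 *m X = 0 -> N1 *m X' = 0 ->
    (forall x, c1 x = 0 <-> im_mx A1 (val x)) ->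
    (forall x y, val y = X *m val x -> c2 y = h (c1 x)) ->
    (forall x y, val y = X' *m val x -> c1 y = h' (c2 x)) ->
    exists Z, X' *m X *m A1 = A1 + A1 *m Z *m A1.
  move=> hK [Ne1 e1K] NA1 NX NX' k1 hX hX'.
  have e1A : e1 *m A1 = A1.
    apply/matrixP => i j; have /e1K : N1 *m (A1 *m delta_mx j 0) = 0 :> 'cV_p1.
      by rewrite mulmxA NA1 mul0mx.
    by rewrite mulmxA -!colE => /matrixP/(_ i 0); rewrite !mxE.
  (* The round trip is the identity on cohomology, so it differs from 1 by boundaries on [ker N1].
     Composing with [e1] turns this into a matrix identity, and [e1 *m A1 = A1] removes [e1]
     again. *)
  have [Z hZ] : exists Z, X' *m X *m e1 - e1 = A1 *m Z.
    apply: im_mx_lift => u.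
    have kx : ker_pred (mulmx N1 : {linear 'cV[R]_m1 -> 'cV[R]_p1}) (e1 *m u).
      by apply/eqP; rewrite /= mulmxA Ne1 mul0mx.
    have ky : ker_pred (mulmx N2 : {linear 'cV[R]_m2 -> 'cV[R]_p2}) (X *m e1 *m u).
      by apply/eqP; rewrite /= !mulmxA NX !mul0mx.
    have kz : ker_pred (mulmx N1 : {linear 'cV[R]_m1 -> 'cV[R]_p1}) (X' *m X *m e1 *m u).
      by apply/eqP; rewrite /= !mulmxA NX' !mul0mx.
    have /k1 : c1 (Sub _ kz - Sub _ kx) = 0.
      rewrite linearB (hX' (Sub _ ky)) /= ?mulmxA //.
      by rewrite (hX (Sub _ kx)) /= ?mulmxA // hK subrr.
    by rewrite mulmxBl.
  exists Z; rewrite -hZ mulmxBl e1A -[_ *m e1 *m A1]mulmxA e1A.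
  by rewrite addrC subrK.
have [X NX hX] := cohomology_lift c f surj' pe.
have [X' NX' hX'] := cohomology_lift c' g surj pe'.
have [Y hY] := half _ _ _ _ _ _ _ _ _ _ _ _ _ _ _ _ NA NX kerc kerc' hX.
have [Y' hY'] := half _ _ _ _ _ _ _ _ _ _ _ _ _ _ _ _ NA' NX' kerc' kerc hX'.
have [Z hZ] := roundtrip _ _ _ _ _ _ _ _ _ _ _ _ _ f g _ _ fK pe NA NX NX' kerc hX hX'.
have [Z' hZ'] := roundtrip _ _ _ _ _ _ _ _ _ _ _ _ _ g f _ _ gK pe' NA' NX' NX kerc' hX' hX.
by exists X, Y, X', Y', Z, Z'.
Qed.

Section DualProjection.
Context (nn : nat -> nat) (D : forall n, 'M[R]_(nn n.+1, nn n)) (j L : nat).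
Context (exD : forall n, (j <= n)%N -> mxexact (D n) (D n.+1)).
Context (nn0 : forall n, (L <= n)%N -> nn n = 0).

(* The complex D is exact beyond j and eventually zero, hence splits there. *)
Lemma ker_proj_ex : exists e, ker_proj (D j) e.
Proof.
suff step k n : (j <= n)%N -> (L <= n + k)%N -> exists e, ker_proj (D n) e.
  by apply: (step L); rewrite ?leq_addl.
elim: k n => [|k IH] n le_jn le_Ln.
  (* Here [D n] has no rows, so its kernel is everything. *)
  rewrite addn0 in le_Ln; exists 1%:M; split=> [|v _]; last by rewrite mul1mx.
  by apply/matrixP => -[x hx]; exfalso; move: hx; rewrite nn0 // leqW.
have [||e [De eK]] := IH n.+1; rewrite ?addSnnS ?leqW //.
have [S hS] := mxexact_lift (exD le_jn) De.
(* [D n *m S] is the projection onto the kernel of [D n.+1], the image of [D n]. Hence D S D = D,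
   and S D projects along the kernel of [D n]. *)
exists (1%:M - S *m D n); split=> [|v Dv]; last first.
  by rewrite mulmxBl mul1mx -mulmxA Dv mulmx0 subr0.
rewrite mulmxBr mulmx1 mulmxA -hS; apply/eqP; rewrite subr_eq0 eq_sym; apply/eqP.
apply/matrixP => x y; have /eK : D n.+1 *m (D n *m delta_mx y 0) = 0 :> 'cV_(_).
  by apply/(exD le_jn); exists (delta_mx y 0).
by rewrite mulmxA -!colE => /matrixP/(_ x 0); rewrite !mxE.
Qed.
End DualProjection.
End MatrixResolution.

(** * From stable equivalence to Clifford equivalence *)

Section StableClifford.
Context (R : comNzRingType).

Lemma mxinj_mul q a c (A : 'M[R]_(q, a)) (M : 'M[R]_(a, c)) :
  mxinj A -> A *m M = 0 -> M = 0.
Proof.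
move=> injA AM; apply/matrixP => i j.
have /injA/matrixP/(_ i 0) : A *m (M *m delta_mx j 0) = 0 :> 'cV_q.
  by rewrite mulmxA AM mul0mx.
by rewrite -colE !mxE.
Qed.

(** Since im e is projective, R^a splits as im e plus [ker A], and the latter is the image of the
    idempotent 1 - S0 A with a shorter resolution. By induction ker A + R^m is isomorphic to R^l,
    whence im e + R^l is isomorphic to R^(a+m). *)
Lemma stably_free_idem n a (e : 'M[R]_n) (A : 'M[R]_(n, a)) (S : 'M[R]_(a, n)) :
    e = A *m S -> e *m A = A -> ffr A ->
  exists m l (U : 'M[R]_(n + m, l)) (V : 'M[R]_(l, n + m)),
    V *m U = 1%:M /\ U *m V = block_mx e 0 0 1%:M.
Proof.
move=> + + [k]; elim: k n a e A S => [|k IH] n a e A S eS eA /=.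
  move=> injA; have SA : S *m A = 1%:M.
    apply/eqP; rewrite -subr_eq0; apply/eqP/(mxinj_mul injA).
    by rewrite mulmxBr mulmx1 mulmxA -eS eA subrr.
  exists 0%N, a, (col_mx A 0), (row_mx S 0); split.
    by rewrite mul_row_col mul0mx addr0.
  rewrite mul_col_row !mulmx0 mul0mx -eS; congr block_mx.
  by apply/matrixP => -[].
case=> b [B [exB fB]].
pose S0 := S *m e.
have ee : e *m e = e by rewrite {2 3}eS mulmxA eA.
have AS0 : A *m S0 = e by rewrite /S0 mulmxA -eS.
have S0e : S0 *m e = S0 by rewrite /S0 -mulmxA ee.
have Ae' : A *m (1%:M - S0 *m A) = 0.
  by rewrite mulmxBr mulmx1 mulmxA AS0 eA subrr.
have [S' hS'] := mxexact_lift exB Ae'.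
have [|m [l [U [V [VU UV]]]]] := IH _ _ (1%:M - S0 *m A) B S' hS' _ fB.
  by rewrite mulmxBl mul1mx -mulmxA (mxexact_mul0 exB) mulmx0 subr0.
exists l, (a + m)%N, (col_mx (row_mx A 0) V), (row_mx (col_mx S0 0) U); split.
  rewrite mul_row_col mul_col_row !mulmx0 !mul0mx UV add_block_mx !add0r.
  by rewrite addrC subrK -scalar_mx_block.
rewrite mul_col_row mul_row_col AS0 mul0mx addr0 VU; congr block_mx.
  rewrite -[U]mulmx1 -VU [U *m _]mulmxA UV mulmxA mul_row_block.
  by rewrite Ae' !mulmx0 !mul0mx !addr0 row_mx0 mul0mx.
rewrite -[V]mul1mx -VU -[V *m U *m V]mulmxA UV -mulmxA mul_block_col.
rewrite !mul0mx !mulmx0 !addr0 mulmxBl mul1mx -mulmxA AS0 S0e subrr.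
by rewrite col_mx0 mulmx0.
Qed.

(* X and X' induce mutually inverse isomorphisms of cokernels *)
Definition cok_iso n b n' b' (B : 'M[R]_(n, b)) (B' : 'M[R]_(n', b'))
    (X : 'M[R]_(n', n)) (X' : 'M[R]_(n, n')) : Prop :=
  [/\ exists Y, X *m B = B' *m Y, exists Y, X' *m B' = B *m Y,
      exists Z, X' *m X = 1%:M + B *m Z & exists Z, X *m X' = 1%:M + B' *m Z].

(* The maps u |-> (X u, - T u) and (u', v) |-> X' u' + v exhibit coker A as a
   direct summand of coker A' (+) R^q; the complement is the image of an
   idempotent L ^ 2 of a free module. *)
Lemma stab_equiv_idem q a q' a' (A : 'M[R]_(q, a)) (A' : 'M[R]_(q', a')) :
  stab_equiv A A' ->
  exists (i : 'M[R]_(q' + q, q)) (r : 'M[R]_(q, q' + q)) (e : 'M[R]_(q' + q)),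
    let B' := col_mx A' 0 : 'M_(q' + q, a') in
    [/\ exists Y, i *m A = B' *m Y, exists Y, r *m B' = A *m Y,
        exists Z, r *m i = 1%:M + A *m Z,
        exists Z, i *m r + e = 1%:M + B' *m Z &
        [/\ e *m e = e, e *m i = 0, e *m B' = 0 &
            exists Z, r *m e = A *m Z]].
Proof.
case=> X [Y [X' [Y' [Z [Z' [h h' hZ hZ']]]]]].
(* The defects of the round trips: they kill [A] and [A'] but need not vanish. The summand R^q
   exists to absorb [T]. *)
pose T := X' *m X - 1%:M - A *m Z; pose T' := X *m X' - 1%:M - A' *m Z'.
have hT : T = X' *m X - (1%:M + A *m Z) by rewrite opprD addrA.
have hT' : T' = X *m X' - (1%:M + A' *m Z') by rewrite opprD addrA.
have TA : T *m A = 0 by rewrite !mulmxBl mul1mx hZ -addrA -opprD subrr.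
have TA' : T' *m A' = 0 by rewrite !mulmxBl mul1mx hZ' -addrA -opprD subrr.
pose B' : 'M_(q' + q, a') := col_mx A' 0.
pose i := col_mx X (- T); pose r : 'M_(q, q' + q) := row_mx X' 1%:M.
(* This is 1 - i r, corrected by [B' *m K] so as to kill [B'] exactly and not only modulo its
   image. *)
pose L : 'M_(q' + q) := block_mx (- T') (- X) (T *m X') (1%:M + T).
pose K : 'M_(a', q' + q) := row_mx Z' 0.
have iA : i *m A = B' *m Y.
  by rewrite mul_col_mx mulNmx TA oppr0 mul_col_mx mul0mx h.
have rB : r *m B' = A *m Y' by rewrite mul_row_col mulmx0 addr0 h'.
have ri : r *m i = 1%:M + A *m Z.
  by rewrite mul_row_col mul1mx hT opprB addrC subrK.
have LB : L *m B' = 0.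
  rewrite mul_block_col !mulmx0 !addr0 mulNmx TA' oppr0 -mulmxA h' mulmxA TA.
  by rewrite mul0mx col_mx0.
have LE : L = 1%:M - i *m r + B' *m K.
  have -> : i *m r = block_mx (X *m X') X (- (T *m X')) (- T).
    by rewrite mul_col_row !mulmx1 mulNmx.
  have -> : B' *m K = block_mx (A' *m Z') 0 0 0.
    by rewrite mul_col_row !mulmx0 !mul0mx.
  rewrite scalar_mx_block opp_block_mx !add_block_mx !addr0 !add0r !opprK.
  by rewrite /L hT' opprB addrAC.
have [J Li] : exists J, L *m i = B' *m J.
  exists (K *m i - Y *m Z); rewrite LE mulmxDl mulmxBl mul1mx -[_ *m r *m i]mulmxA ri.
  rewrite mulmxDr mulmx1 opprD addNKr mulmxA iA mulmxBr !mulmxA addrC.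
  by [].
(* [L] sends [i] into the image of [B'], which [L] kills; so the square kills [i], and then L^3 =
   L^2 makes it idempotent. *)
pose e := L *m L.
have LLi : L *m L *m i = 0 by rewrite -mulmxA Li mulmxA LB mul0mx.
have L3 : L *m L *m L = L *m L.
  by rewrite {3}LE mulmxDr mulmxBr mulmx1 !mulmxA LLi mul0mx subr0
    -[L *m L *m B']mulmxA LB mulmx0 mul0mx addr0.
have eE : e = 1%:M - i *m r + B' *m (K - J *m r).
  rewrite /e {2}LE mulmxDr mulmxBr mulmx1 !mulmxA LB mul0mx addr0 Li {1}LE.
  by rewrite mulmxBr !mulmxA addrA.
exists i, r, e; split; [by exists Y|by exists Y'|by exists Z| |split].
- by exists (K - J *m r); rewrite eE addrA addrCA subrr addr0.
- by rewrite /e mulmxA L3 L3.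
- exact: LLi.
- by rewrite /e -mulmxA LB mulmx0.
exists (Y' *m (K - J *m r) - Z *m r).
have rir : r *m (1%:M - i *m r) = - (A *m (Z *m r)).
  rewrite mulmxBr mulmx1 [r *m (_ *m _)]mulmxA ri mulmxDl mul1mx opprD addrA.
  by rewrite subrr add0r mulmxA.
by rewrite eE (mulmxDr r) rir [r *m _]mulmxA rB -mulmxA addrC -mulmxBr.
Qed.

(** The complement im e is stably free: adding R^m makes it R^l. The zero rows add free summands to
    the cokernels, so coker A + R^l is isomorphic to coker A' + R^(q+m). *)
Lemma stab_equiv_cok_iso q a q' a' (A : 'M[R]_(q, a)) (A' : 'M[R]_(q', a')) :
    (forall n b (F : 'M[R]_(n, b)), ffr F) -> stab_equiv A A' ->
  exists l m (X : 'M[R]_(q' + m, q + l)) (X' : 'M[R]_(q + l, q' + m)),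
    cok_iso (col_mx A 0) (col_mx A' 0) X X'.
Proof.
move=> ffrR /stab_equiv_idem[i [r [e [[Y iA] [Y' rB] [Z ri] [Z' ire]]]]].
case=> ee ei eB [Z2 re].
have [m [l [U [V [VU UV]]]]] :=
  stably_free_idem (esym ee) ee (ffrR _ _ e).
set B' := col_mx A' 0 in iA rB ire eB.
pose B2 : 'M_(q' + q + m, a') := col_mx B' 0.
pose X : 'M_(q' + q + m, q + l) := row_mx (col_mx i 0) U.
pose X' : 'M_(q + l, q' + q + m) := col_mx (row_mx r 0) V.
have isoB : cok_iso (col_mx A 0 : 'M_(q + l, a)) B2 X X'.
  split.
  - exists Y; rewrite mul_row_col mulmx0 addr0 !mul_col_mx !mul0mx.
    by rewrite iA mul_col_mx mul0mx.
  - exists Y'; rewrite mul_col_mx mul_row_col mulmx0 addr0 rB mul_col_mx mul0mx.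
    congr col_mx; rewrite -[V]mul1mx -VU -[V *m U *m V]mulmxA UV -mulmxA.
    by rewrite mul_block_col eB !mulmx0 mul0mx !addr0 col_mx0 mulmx0.
  - exists (row_mx Z (Z2 *m usubmx U)).
    have rU : row_mx r 0 *m U = A *m Z2 *m usubmx U.
      rewrite -{1}[U]mulmx1 -VU [U *m _]mulmxA UV -re.
      rewrite -{1}[U]vsubmxK mul_block_col mul_row_col !mul0mx !addr0 mulmxA.
      by [].
    have Vi : V *m col_mx i 0 = 0.
      rewrite -[V]mul1mx -VU -[V *m U *m V]mulmxA UV -mulmxA mul_block_col.
      by rewrite ei !mulmx0 mul0mx !addr0 col_mx0 mulmx0.
    rewrite mul_col_row mul_row_col mul0mx addr0 ri rU Vi VU mul_col_row !mul0mx.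
    by rewrite scalar_mx_block add_block_mx !addr0 add0r mulmxA.
  exists (row_mx Z' 0); rewrite mul_row_col mul_col_row !mulmx0 !mul0mx UV.
  rewrite add_block_mx !add0r ire mul_col_row !mulmx0 mul0mx.
  rewrite (scalar_mx_block (q' + q) m).
  by rewrite add_block_mx !add0r addr0.
have eB2 : col_mx A' 0 = castmx (esym (addnA q' q m), erefl a') B2.
  by rewrite -[X in col_mx A' X](col_mx0 R q m a') col_mxA.
exists l, (q + m)%N; rewrite eB2.
move: (esym (addnA q' q m)) => eqm {eB2}.
move: (q' + q + m)%N (q' + (q + m))%N eqm B2 X X' isoB => n' n'' eqm.
by case: n'' / eqm => B2 X X' isoB; rewrite castmx_id; exists X, X'.
Qed.

(** Fitting's matrix, invertible for arbitrary X and X': exchanging the two gives the inverse. *)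
Definition fitting_mx n n' (X : 'M[R]_(n', n)) (X' : 'M[R]_(n, n')) :
  'M[R]_(n' + n, n + n') := block_mx X (1%:M - X *m X') 1%:M (- X').

Lemma fitting_mxK n n' (X : 'M[R]_(n', n)) (X' : 'M[R]_(n, n')) :
  fitting_mx X X' *m fitting_mx X' X = 1%:M.
Proof.
rewrite mulmx_block !mulmx1 !mul1mx !mulNmx !mulmxN ?mulNmx subrr opprK.
rewrite mulmxBr mulmxBl mulmx1 mul1mx mulmxA subrr.
by rewrite addrC !subrK -scalar_mx_block.
Qed.

(** The corner 1 - X X' is a multiple of B' because X X' is the identity on coker B'. *)
Lemma fitting_im n b n' b' (B : 'M[R]_(n, b)) (B' : 'M[R]_(n', b')) X X' :
  cok_iso B B' X X' ->
  exists W, fitting_mx X X' *m block_mx B 0 0 1%:M = block_mx B' 0 0 1%:M *m W.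
Proof.
case=> [[Y h] _ _ [Z hZ]]; exists (block_mx Y (- Z) B (- X')).
rewrite !mulmx_block !mulmx0 !mulmx1 !mul0mx !mul1mx !addr0 !add0r h hZ.
by rewrite opprD addNKr mulmxN.
Qed.

Lemma cok_iso_sym n b n' b' (B : 'M[R]_(n, b)) (B' : 'M[R]_(n', b')) X X' :
  cok_iso B B' X X' -> cok_iso B' B X' X.
Proof. by case. Qed.

Definition swap_mx q l m : 'M[R]_(q + m + l, q + l + m) :=
  block_mx (block_mx 1%:M 0 0 0) (col_mx 0 1%:M) (row_mx 0 1%:M) 0.

Lemma swap_mxK q l m : swap_mx q l m *m swap_mx q m l = 1%:M.
Proof.
rewrite mulmx_block mulmx_block mul_col_row mul_block_col mul_row_block mul_row_col.
rewrite !(mulmx0, mul0mx, mulmx1, addr0, add0r) add_block_mx !(addr0, add0r).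
by rewrite col_mx0 row_mx0 -!scalar_mx_block.
Qed.

Lemma swap_mxE q l m a (A : 'M[R]_(q, a)) :
  swap_mx q l m *m block_mx (col_mx A 0) 0 0 1%:M =
    col_mx (block_mx A 0 0 1%:M) 0.
Proof.
rewrite mulmx_block mul_block_col mul_row_col !mul_col_mx.
rewrite !(mulmx0, mul0mx, mulmx1, mul1mx, addr0, add0r) /block_mx.
rewrite row_mx0; congr col_mx.
by rewrite !col_mx0 addr0 add0r -block_mxEh.
Qed.

(** Multiplying such matrices adds their corners, so a single nonzero entry suffices. *)
Lemma in_E_upper m n (M : 'M[R]_(m, n)) : in_E (block_mx 1%:M M 0 1%:M).
Proof.
have add (M1 M2 : 'M[R]_(m, n)) : block_mx 1%:M (M1 + M2) 0 1%:M =
    block_mx 1%:M M1 0 1%:M *m block_mx 1%:M M2 0 1%:M.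
  by rewrite mulmx_block !(mulmx0, mul0mx, mulmx1, mul1mx, addr0, add0r) addrC.
rewrite (matrix_sum_delta M).
have P0 : in_E (block_mx 1%:M (0 : 'M[R]_(m, n)) 0 1%:M).
  by rewrite -scalar_mx_block; apply: in_E_one.
apply: (big_ind (fun M : 'M[R]_(m, n) => in_E (block_mx 1%:M M 0 1%:M))) => //.
  by move=> M1 M2; rewrite add; apply: in_E_mul.
move=> i _; apply: (big_ind (fun M : 'M[R]_(m, n) => in_E (block_mx 1%:M M 0 1%:M))) => //.
  by move=> M1 M2; rewrite add; apply: in_E_mul.
move=> j _.
have -> : block_mx 1%:M (M i j *: delta_mx i j) 0 1%:M =
    1%:M + M i j *: delta_mx (lshift n i) (rshift m j).
  rewrite scalar_mx_block -[delta_mx (lshift _ _) _](submxK) scale_block_mx.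
  rewrite add_block_mx; congr block_mx; apply/matrixP => x y; rewrite !mxE;
  by rewrite ?eq_lshift ?eq_rshift ?eq_lrshift ?eq_rlshift ?andbF ?mulr0 ?addr0 ?add0r.
by apply: in_E_gen; rewrite eq_lrshift.
Qed.

Lemma in_E_lower m n (M : 'M[R]_(n, m)) : in_E (block_mx 1%:M 0 M 1%:M).
Proof.
have add (M1 M2 : 'M[R]_(n, m)) : block_mx 1%:M 0 (M1 + M2) 1%:M =
    block_mx 1%:M 0 M1 1%:M *m block_mx 1%:M 0 M2 1%:M.
  by rewrite mulmx_block !(mulmx0, mul0mx, mulmx1, mul1mx, addr0, add0r).
rewrite (matrix_sum_delta M).
have P0 : in_E (block_mx 1%:M 0 (0 : 'M[R]_(n, m)) 1%:M).
  by rewrite -scalar_mx_block; apply: in_E_one.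
apply: (big_ind (fun M : 'M[R]_(n, m) => in_E (block_mx 1%:M 0 M 1%:M))) => //.
  by move=> M1 M2; rewrite add; apply: in_E_mul.
move=> i _; apply: (big_ind (fun M : 'M[R]_(n, m) => in_E (block_mx 1%:M 0 M 1%:M))) => //.
  by move=> M1 M2; rewrite add; apply: in_E_mul.
move=> j _.
have -> : block_mx 1%:M 0 (M i j *: delta_mx i j) 1%:M =
    1%:M + M i j *: delta_mx (rshift m i) (lshift n j).
  rewrite scalar_mx_block -[delta_mx (rshift _ _) _](submxK) scale_block_mx.
  rewrite add_block_mx; congr block_mx; apply/matrixP => x y; rewrite !mxE;
  by rewrite ?eq_lshift ?eq_rshift ?eq_lrshift ?eq_rlshift ?andbF ?mulr0 ?addr0 ?add0r.
by apply: in_E_gen; rewrite eq_rlshift.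
Qed.

Lemma in_E_whitehead n (U U' : 'M[R]_n) :
  U *m U' = 1%:M -> U' *m U = 1%:M -> in_E (block_mx U 0 0 U').
Proof.
move=> UU' U'U.
(* The first three factors give the antidiagonal matrix with entries U and - U', the last three the
   one with entries -1 and 1. *)
have -> : block_mx U 0 0 U' =
    block_mx 1%:M U 0 1%:M *m block_mx 1%:M 0 (- U') 1%:M *m
    block_mx 1%:M U 0 1%:M *m (block_mx 1%:M (- 1%:M) 0 1%:M *m
    block_mx 1%:M 0 1%:M 1%:M *m block_mx 1%:M (- 1%:M) 0 1%:M).
  rewrite !mulmx_block !(mulmx0, mul0mx, mulmx1, mul1mx, addr0, add0r).
  rewrite !(mulmxN, mulNmx, mulmx1, mul1mx, UU', U'U) ?mulmxDl ?mulNmx.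
  rewrite !(UU', U'U, subrr, addNr, oppr0, mulmx0, mul0mx, mulmx1, addr0, add0r).
  by rewrite mulmxN mulmx1 opprK.
by do !apply: in_E_mul; apply: in_E_upper || apply: in_E_lower.
Qed.

(** The [N] extra zero rows leave room for [U'] beside [U], so an invertible row operation becomes
    elementary. *)
Lemma cliff_equiv_pad N N' c c' (eN : N' = N) (e1 : (N' + N = N + N)%N)
    (e2 : c' = c) (S : 'M[R]_(N, c)) (S' : 'M[R]_(N', c'))
    (U : 'M_(N', N)) (U' : 'M_(N, N')) (F : 'M_(c, c')) (F' : 'M_(c', c)) :
    U *m U' = 1%:M -> U' *m U = 1%:M -> F *m F' = 1%:M -> F' *m F = 1%:M ->
    U *m S *m F = S' ->
  cliff_equiv (col_mx S (0 : 'M_(N, c))) (castmx (e1, e2) (col_mx S' (0 : 'M_(N, c')))).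
Proof.
subst N' c' => UU' U'U FF' F'F <-; rewrite castmx_id.
exists (block_mx U 0 0 U'), F; split; first exact: in_E_whitehead.
  by exists F'.
by rewrite mul_block_col !mulmx0 !addr0 mul0mx mul_col_mx mul0mx.
Qed.
Lemma stab_pad q a (A : 'M[R]_(q, a)) al be et N :
  stab A al (be + N) et =
    castmx (esym (addnA (q + al) be N), erefl (a + al + et)%N)
      (col_mx (row_mx (col_mx (block_mx A 0 0 1%:M) 0) 0) 0).
Proof.
rewrite -[X in row_mx _ X](col_mx0 R (q + al) be et) -block_mxEh.
by rewrite /stab {1 3}/block_mx !row_mx0 -col_mxA col_mx0.
Qed.

Lemma cliff_equiv_cast n c n' c' (A B : 'M[R]_(n, c)) (e : n = n') (f : c = c') :
  cliff_equiv A B -> cliff_equiv (castmx (e, f) A) (castmx (e, f) B).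
Proof. by subst n' c'; rewrite !castmx_id. Qed.

(** Fitting's matrix, conjugated by permutations of blocks, matches the images of the two padded
    matrices by invertible row operations. The factors [W], [W'] between the generating families
    need not be invertible, so the same trick is repeated on columns. *)
Lemma cok_iso_cliff q a q' a' (A : 'M[R]_(q, a)) (A' : 'M[R]_(q', a')) l m
    (X : 'M[R]_(q' + m, q + l)) (X' : 'M[R]_(q + l, q' + m)) :
  cok_iso (col_mx A 0) (col_mx A' 0) X X' -> cliff_stequiv A A'.
Proof.
move=> iso; have [W hW] := fitting_im iso.
have [W' hW'] := fitting_im (cok_iso_sym iso).
set n := (q + l)%N in X X' iso W hW W' hW'.
set n' := (q' + m)%N in X X' iso W hW W' hW'.
pose S0 : 'M[R]_(q + n' + l, a + n') := col_mx (block_mx A 0 0 1%:M) 0.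
pose S0' : 'M[R]_(q' + n + m, a' + n) := col_mx (block_mx A' 0 0 1%:M) 0.
pose U := swap_mx q' m n *m fitting_mx X X' *m swap_mx q n' l.
pose U' := swap_mx q l n' *m fitting_mx X' X *m swap_mx q' n m.
have US : U *m S0 = S0' *m W.
  rewrite /S0 /S0' -!swap_mxE /U -!mulmxA [swap_mx q n' l *m _]mulmxA.
  by rewrite swap_mxK mul1mx hW.
have US' : U' *m S0' = S0 *m W'.
  rewrite /S0 /S0' -!swap_mxE /U' -!mulmxA [swap_mx q' n m *m _]mulmxA.
  by rewrite swap_mxK mul1mx hW'.
have UU' : U *m U' = 1%:M.
  rewrite /U /U' -!mulmxA [swap_mx q n' l *m _]mulmxA swap_mxK mul1mx.
  by rewrite [fitting_mx X X' *m _]mulmxA fitting_mxK mul1mx swap_mxK.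
have U'U : U' *m U = 1%:M.
  rewrite /U /U' -!mulmxA [swap_mx q' n m *m _]mulmxA swap_mxK mul1mx.
  by rewrite [fitting_mx X' X *m _]mulmxA fitting_mxK mul1mx swap_mxK.
have SWW : S0' *m W *m W' = S0' by rewrite -US -mulmxA -US' mulmxA UU' mul1mx.
pose N := (q + n' + l)%N.
have eN : (q' + n + m = N)%N by rewrite /N /n /n'; lia.
have ec : (a' + n + (a + n') = a + n' + (a' + n))%N by rewrite addnC.
have e1 : (q' + n + m + N = N + N)%N by rewrite eN.
have eq_q : (q' + n + (m + N) = q + n' + (l + N))%N by rewrite /N /n /n'; lia.
exists n', (l + N)%N, (a' + n)%N, n, (m + N)%N, (a + n')%N, eq_q, ec.
(* Each side receives as many zero columns as the other has columns; [fitting_mx W' W] works because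
   S0' W W' = S0'. *)
have FUS : U *m row_mx S0 0 *m fitting_mx W' W = row_mx S0' 0.
  rewrite mul_mx_row mulmx0 US mul_row_block !mul0mx !addr0 SWW.
  by rewrite mulmxBr mulmx1 mulmxA SWW subrr.
have := cliff_equiv_pad eN e1 ec UU' U'U (fitting_mxK W' W) (fitting_mxK W W') FUS.
move/(cliff_equiv_cast (esym (addnA (q + n') l N)) (erefl (a + n' + (a' + n))%N)).
rewrite !stab_pad !castmx_comp.
by congr (cliff_equiv _ (castmx (_, _) _)); apply: eq_irrelevance.
Qed.

Lemma stab_equiv_cliff q a q' a' (A : 'M[R]_(q, a)) (A' : 'M[R]_(q', a')) :
    (forall n b (F : 'M[R]_(n, b)), ffr F) -> stab_equiv A A' ->
  cliff_stequiv A A'.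
Proof.
move=> ffrR /(stab_equiv_cok_iso ffrR)[l [m [X [X' iso]]]].
exact: cok_iso_cliff iso.
Qed.
End StableClifford.

(** * Conjugated cokernels and the descent from Ext to the code matrices *)

Section TwistedCokernel.
Context (R : comNzRingType) (s : {rmorphism R -> R}) (sK : involutive s).

Let map_sK m n : involutive (@map_mx _ _ s m n).
Proof. by move=> A; apply/matrixP => i j; rewrite !mxE sK. Qed.

Section Augmentation.
Context (q a : nat) (phi : 'M[R]_(q, a)).

(** Conjugating the entries makes the projection linear for the twisted action, so the twisted
    cokernel is presented by [map_mx s phi]. *)
Definition coker_aug (v : 'cV[R]_q) : twist s (coker phi) :=
  cokproj (mulmx phi : {linear 'cV[R]_a -> 'cV[R]_q}) (map_mx s v).

Lemma coker_aug_is_linear : linear coker_aug.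
Proof.
by move=> r u v; rewrite /coker_aug map_mxD map_mxZ linearP.
Qed.

HB.instance Definition _ := GRing.isLinear.Build R 'cV[R]_q (twist s (coker phi))
  _ coker_aug coker_aug_is_linear.

Lemma coker_aug_surj x : exists v, x = coker_aug v.
Proof.
exists (map_mx s (repr (x : coker phi))); rewrite /coker_aug map_sK.
by rewrite cokprojK.
Qed.

Lemma coker_aug_eq0 v : coker_aug v = 0 <-> im_mx (map_mx s phi) v.
Proof.
rewrite /coker_aug; split=> [/cokproj_eq0[u hu]|[u ->]].
  by exists (map_mx s u); rewrite -map_mxM -hu map_sK.
by apply/cokproj_eq0; exists (map_mx s u); rewrite map_mxM map_sK.
Qed.
End Augmentation.

Lemma coker_resolution q a (phi : 'M[R]_(q, a)) : ffr (map_mx s phi) ->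
  exists (nn : nat -> nat) (d : forall n, 'M[R]_(nn n, nn n.+1)),
  exists e : {linear 'cV[R]_(nn 0) -> twist s (coker phi)},
    [/\ resolution (P := fun n => 'cV[R]_(nn n))
          (fun n => mulmx (d n) : {linear 'cV[R]_(nn n.+1) -> 'cV[R]_(nn n)}) e,
        exists L, forall n, (L <= n)%N -> nn n = 0 &
        exists (eq : nn 0 = q) (ea : nn 1 = a), castmx (eq, ea) (d 0) = map_mx s phi].
Proof.
case/ffr_sequence=> nn [d [eq [ea [d0 exd fin]]]].
case: q / eq phi d0 => phi; case: a / ea phi => phi; rewrite castmx_id => d0.
exists nn, d, (@coker_aug _ _ phi); split=> //; last by exists erefl, erefl.
split=> [x|v|n v]; [exact: coker_aug_surj| |exact: (exd n v)].
by rewrite coker_aug_eq0 -d0.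
Qed.

Lemma stab_equiv_cast q a q' a' m b m' b' (A : 'M[R]_(q, a)) (A' : 'M[R]_(q', a'))
    (eq : q = m) (ea : a = b) (eq' : q' = m') (ea' : a' = b') :
  stab_equiv A A' -> stab_equiv (castmx (eq, ea) A) (castmx (eq', ea') A').
Proof. by subst m b m' b'; rewrite !castmx_id. Qed.

Lemma Ext_stab_equiv (ffrR : forall n b (F : 'M[R]_(n, b)), ffr F)
    q1 a1 q2 a2 (phi1 : 'M[R]_(q1, a1)) (phi2 : 'M[R]_(q2, a2)) j : (1 <= j)%N ->
    (forall l, (0 < l)%N -> l <> j -> trivial_mod (Ext (twist s (coker phi1)) R^o l)) ->
    (forall l, (0 < l)%N -> l <> j -> trivial_mod (Ext (twist s (coker phi2)) R^o l)) ->
    lmod_iso (Ext (twist s (coker phi1)) R^o j) (Ext (twist s (coker phi2)) R^o j) ->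
  stab_equiv phi1 phi2.
Proof.
(* From here on the Ext degree in question is [j.+1], read off between [(d j)^T] and
   [(d j.+1)^T]. *)
case: j => // j _ ext1 ext2 ext12.
have [nn1 [d1 [e1 [res1 [L1 fin1] [eq1 [ea1 d10]]]]]] :=
  coker_resolution (ffrR _ _ (map_mx s phi1)).
have [nn2 [d2 [e2 [res2 [L2 fin2] [eq2 [ea2 d20]]]]]] :=
  coker_resolution (ffrR _ _ (map_mx s phi2)).
have ex1 n : n <> j -> mxexact (d1 n)^T (d1 n.+1)^T.
  by move=> nj; apply: (Ext_exact res1); apply: ext1 => // -[].
have ex2 n : n <> j -> mxexact (d2 n)^T (d2 n.+1)^T.
  by move=> nj; apply: (Ext_exact res2); apply: ext2 => // -[].
have base : stab_equiv (d1 j)^T (d2 j)^T.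
  have [c1 [surj1 ker1]] := Ext_matrix res1 j.
  have [c2 [surj2 ker2]] := Ext_matrix res2 j.
  have [|p1 hp1] := @ker_proj_ex R nn1 (fun n => (d1 n)^T) j.+1 L1 _ fin1.
    by move=> n jn; apply: ex1 => nj; rewrite nj ltnn in jn.
  have [|p2 hp2] := @ker_proj_ex R nn2 (fun n => (d2 n)^T) j.+1 L2 _ fin2.
    by move=> n jn; apply: ex2 => nj; rewrite nj ltnn in jn.
  have dd1 : (d1 j.+1)^T *m (d1 j)^T = 0.
    by case: res1 => _ _ ex; rewrite -trmx_mul (mxexact_mul0 (ex j)) trmx0.
  have dd2 : (d2 j.+1)^T *m (d2 j)^T = 0.
    by case: res2 => _ _ ex; rewrite -trmx_mul (mxexact_mul0 (ex j)) trmx0.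
  exact: cohomology_stab_equiv dd1 dd2 hp1 hp2 surj1 surj2 ker1 ker2 ext12.
have desc k n : (n + k = j)%N -> stab_equiv (d1 n)^T (d2 n)^T.
  elim: k n => [|k IH] n nk; first by rewrite addn0 in nk; rewrite nk.
  have nj : n <> j by move=> nj; move: nk; rewrite nj; lia.
  apply: stab_equiv_exact (ex1 n nj) (ex2 n nj) _.
  by apply: IH; rewrite addSnnS.
have := stab_equiv_tr (desc j 0 (add0n j)); rewrite !trmxK => h0.
rewrite -[phi1]map_sK -[phi2]map_sK; apply: stab_equiv_map.
by rewrite -d10 -d20; apply: stab_equiv_cast.
Qed.
End TwistedCokernel.

Lemma bar_involutive (k : comNzRingType) (G : zmodType) : involutive (@bar k G).
Proof. by move=> g; apply/malgP => u; rewrite !barE opprK. Qed.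

Theorem corollary3 (p D : nat) (p_prime : prime p)
    (q1 a1 b1 q2 a2 b2 : nat)
    (phi1X : 'M[laurent p D]_(q1, a1)) (phi1Z : 'M[laurent p D]_(q1, b1))
    (phi2X : 'M[laurent p D]_(q2, a2)) (phi2Z : 'M[laurent p D]_(q2, b2))
    (code1 : topological_css_code phi1X phi1Z)
    (code2 : topological_css_code phi2X phi2Z)
    (j : nat) (j_ge1 : (1 <= j)%N)
    (ext1 : forall l : nat, (0 < l)%N -> l <> j ->
       trivial_mod (Ext (conj_mod (coker phi1X)) (laurent p D)^o l))
    (ext2 : forall l : nat, (0 < l)%N -> l <> j ->
       trivial_mod (Ext (conj_mod (coker phi2X)) (laurent p D)^o l))
    (ext12 : lmod_iso (Ext (conj_mod (coker phi1X)) (laurent p D)^o j)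
                      (Ext (conj_mod (coker phi2X)) (laurent p D)^o j)) :
  cliff_stequiv phi1X phi2X.
Proof.
have [_ ffrR] := laurent_ffr 'F_p D; apply: stab_equiv_cliff => //.
pose s : {rmorphism laurent p D -> laurent p D} := @bar 'F_p 'rV[int]_D.
have sK : involutive s := @bar_involutive _ _.
exact: (@Ext_stab_equiv _ s sK ffrR _ _ _ _ phi1X phi2X j j_ge1 ext1 ext2 ext12).
Qed.
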